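(* Let $k$ be a field with a non-archimedean valuation $\nu:k\to\mathbb{T}$. If $X$ is an affine integral scheme of finite type over $k$, then the limit (in the category of $\mathbb{T}$-schemes) of its tropicalizations $\mathrm{Trop}_\varphi(X)$ with respect to all closed embeddings $\varphi$ of $X$ in finite-dimensional affine spaces is naturally isomorphic as a $\mathbb{T}$-scheme to the universal tropicalization $\mathrm{Trop}_{univ}(X)$.
   Context: All monoids, rings and semirings are commutative with multiplicative unit; semirings have an additive unit. $\mathbb{T}=(\mathbb{R}\cup\{\infty\},\min,+)$, with $0_{\mathbb{T}}=\infty$ and $1_{\mathbb{T}}=0$. A valuation $\nu:k\to\mathbb{T}$ is a map with $\nu(0)=0_{\mathbb{T}}$, $\nu(1)=\nu(-1)=1_{\mathbb{T}}$, $\nu(ab)=\nu(a)\nu(b)$ and $\nu(a+b)+\nu(a)+\nu(b)=\nu(a)+\nu(b)$ (operations of $\mathbb{T}$ on the right-hand objects). An $\mathbb{F}_1$-algebra is a commutative monoid-with-zero $B$; homomorphisms preserve $1$, products and $0$; $B$ is integral if its nonzero elements form a cancellative monoid. For a (semi)ring $R$, $B\otimes_{\mathbb{F}_1}R$ is the $R$-algebra generated by symbols $x_b$ ($b\in B$) with $x_ax_b=x_{ab}$, $x_1=1$, $x_0=0$. For an $R$-algebra $A$, $M(A)$ is its underlying multiplicative monoid-with-zero. $\mathbb{F}_1[x_1,\dots,x_n]$ is the free commutative monoid on $n$ generators with a zero adjoined. Tropicalization. Let $X=\mathrm{Spec}\,A$, $B$ an integral $\mathbb{F}_1$-algebra,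 and $\psi:B\otimes_{\mathbb{F}_1}k\twoheadrightarrow A$ a surjection of $k$-algebras, with corresponding closed embedding $\varphi$ of $X$. Let $\mathrm{trop}(\ker\psi)\subset B\otimes_{\mathbb{F}_1}\mathbb{T}$ be the ideal generated by the elements $\nu(f)=\sum\nu(\lambda_i)x_{b_i}$ for $f=\sum\lambda_ix_{b_i}\in\ker\psi$, and let $\mathcal{B}\,\mathrm{trop}(\ker\psi)$ be the semiring congruence generated by the bend relations $g\sim g_{\widehat{b}}$ for $g\in\mathrm{trop}(\ker\psi)$ and $b$ a monomial term of $g$, where $g_{\widehat{b}}$ is $g$ with that term deleted. Then $\mathrm{Trop}_\varphi(X)=\mathrm{Spec}(B\otimes_{\mathbb{F}_1}\mathbb{T}/\mathcal{B}\,\mathrm{trop}(\ker\psi))$. The universal tropicalization $\mathrm{Trop}_{univ}(X)$ is the case $B=M(A)$ and $\psi=ev:M(A)\otimes_{\mathbb{F}_1}k\to A$, $x_a\mapsto a$. Indexing category of the limit. The objects are closed embeddings of $X$ into affine spaces $\mathbb{A}^n_k$ for varying finite $n$, i.e. surjections $B\otimes_{\mathbb{F}_1}k\twoheadrightarrow A$ with $B\cong\mathbb{F}_1[x_1,\dots,x_n]$; morphisms are the morphisms of affine spaces induced by homomorphisms $B_1\to B_2$ of $\mathbb{F}_1$-algebras compatible with the surjections onto $A$ (in the opposite direction on schemes). Such a morphism induces a morphism of the tropicalizations, so tropicalization is a functor from this category to $\mathbb{T}$-schemes. Schemes over a semiring are built by gluing affine schemes (opposite category of algebras over the semiring) along localizations.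 *)

(* Defs.v *)
From HB Require Import structures.
From mathcomp Require Import all_boot all_order all_algebra.
From mathcomp Require Import finmap generic_quotient.
From mathcomp Require Import boolp.
From mathcomp Require Import reals.

Set Implicit Arguments.
Unset Strict Implicit.
Unset Printing Implicit Defensive.

Import Order.TTheory GRing.Theory Num.Theory.

Local Open Scope ring_scope.
Local Open Scope quotient_scope.

(* [None] is the point at infinity; semiring addition is the minimum and
   semiring multiplication is the addition of real numbers. *)
Definition tropical (R : realType) : Type := option R.

Section Tropical.
Variable R : realType.
Local Notation T := (tropical R).

HB.instance Definition _ := Choice.on T.

Definition trop_add (x y : T) : T :=
  match x, y with
  | Some a, Some b => Some (Num.min a b)
  | Some a, None => Some a
  | None, _ => y
  end.

Definition trop_mul (x y : T) : T :=
  match x, y with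
  | Some a, Some b => Some (a + b)
  | _, _ => None
  end.

Fact trop_addA : associative trop_add.
Proof. by move=> [x|] [y|] [z|] //=; rewrite minA. Qed.

Fact trop_addC : commutative trop_add.
Proof. by move=> [x|] [y|] //=; rewrite minC. Qed.

Fact trop_add0 : left_id None trop_add.
Proof. by case. Qed.

Fact trop_mulA : associative trop_mul.
Proof. by move=> [x|] [y|] [z|] //=; rewrite addrA. Qed.

Fact trop_mulC : commutative trop_mul.
Proof. by move=> [x|] [y|] //=; rewrite addrC. Qed.

Fact trop_mul1 : left_id (Some 0) trop_mul.
Proof. by case=> //= x; rewrite add0r. Qed.

Fact trop_mulD : left_distributive trop_mul trop_add.
Proof. by move=> [x|] [y|] [z|] //=; rewrite addr_minl. Qed.

Fact trop_mul0 : left_zero None trop_mul.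
Proof. by []. Qed.

HB.instance Definition _ :=
  GRing.isNmodule.Build T trop_addA trop_addC trop_add0.

Fact trop_mul1r : right_id (Some 0) trop_mul.
Proof. by move=> x; rewrite trop_mulC trop_mul1. Qed.

Fact trop_mulDr : right_distributive trop_mul trop_add.
Proof. by move=> x y z; rewrite !(trop_mulC x) trop_mulD. Qed.

Fact trop_mul0r : right_zero None trop_mul.
Proof. by case. Qed.

HB.instance Definition _ := GRing.Nmodule_isPzSemiRing.Build T
  trop_mulA trop_mul1 trop_mul1r trop_mulD trop_mulDr trop_mul0 trop_mul0r.
HB.instance Definition _ :=
  GRing.PzSemiRing_hasCommutativeMul.Build T trop_mulC.

End Tropical.

(* Sums and products on the right-hand sides are those of the tropical
   semiring. *)
Record valuation (k : fieldType) (R : realType) := Valuation {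
  val_fun :> k -> tropical R;
  val0 : val_fun 0 = 0;
  val1 : val_fun 1 = 1;
  valN1 : val_fun (- 1) = 1;
  valM : forall a b, val_fun (a * b) = val_fun a * val_fun b;
  valD : forall a b,
    val_fun (a + b) + (val_fun a + val_fun b) = val_fun a + val_fun b
}.

(* The library's [comSemiAlgType] excludes the zero algebra, which does occur
   as a localization, so an algebra is a semiring with a structure map. *)
Record cAlg (S : comPzSemiRingType) := CAlg {
  alg_car :> comPzSemiRingType;
  alg_str : {rmorphism S -> alg_car}
}.
Arguments alg_str {S} c.

Record algHom (S : comPzSemiRingType) (A B : cAlg S) := AlgHom {
  alg_map :> {rmorphism A -> B};
  alg_mapE : forall r, alg_map (alg_str A r) = alg_str B r
}.

Definition alg_of_comAlg (k : fieldType) (A : comAlgType k) : cAlg k :=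
  CAlg (GRing.in_alg A).

Section AlgHom.
Variable S : comPzSemiRingType.
Implicit Types A B C : cAlg S.

Lemma algHom_ext A B (f g : algHom A B) : f =1 g -> f = g.
Proof.
case: f g => [[f [[[f0 fD]] [[f1 fM]]]] fE] [[g [[[g0 gD]] [[g1 gM]]]] gE] fg.
have efg : f = g by apply/funext.
subst g.
have ? := Prop_irrelevance g0 f0; have ? := Prop_irrelevance gD fD.
have ? := Prop_irrelevance g1 f1; have ? := Prop_irrelevance gM fM.
subst g0 gD g1 gM; congr AlgHom; exact: Prop_irrelevance.
Qed.

Definition algHom_id A : algHom A A := @AlgHom S A A idfun (fun _ => erefl).

Fact algHom_compE A B C (g : algHom B C) (f : algHom A B) r :
  (g \o f) (alg_str A r) = alg_str C r.
Proof. by rewrite /= !alg_mapE. Qed.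

Definition algHom_comp A B C (g : algHom B C) (f : algHom A B) : algHom A C :=
  @AlgHom S A C (g \o f) (algHom_compE g f).

End AlgHom.

Record F1alg := F1Alg {
  F1car :> choiceType;
  F1mul : F1car -> F1car -> F1car;
  F1one : F1car;
  F1zero : F1car;
  F1mulA : associative F1mul;
  F1mulC : commutative F1mul;
  F1mul1 : left_id F1one F1mul;
  F1mul0 : left_zero F1zero F1mul
}.
Arguments F1mul {f}.
Arguments F1one {f}.
Arguments F1zero {f}.

Record F1hom (B C : F1alg) := F1Hom {
  F1fun :> B -> C;
  F1hom1 : F1fun F1one = F1one;
  F1homM : forall a b, F1fun (F1mul a b) = F1mul (F1fun a) (F1fun b);
  F1hom0 : F1fun F1zero = F1zero
}.

(* The nonzero elements form a monoid (hence the first two clauses), which is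
   cancellative. *)
Record F1integral (B : F1alg) : Prop := F1Integral {
  F1int_one : F1one <> F1zero :> B;
  F1int_mul : forall a b : B,
    a <> F1zero -> b <> F1zero -> F1mul a b <> F1zero;
  F1int_cancel : forall a b c : B, a <> F1zero -> b <> F1zero -> c <> F1zero ->
    F1mul a b = F1mul a c -> b = c
}.

Section F1Theory.

Lemma F1mulr0 (B : F1alg) (a : B) : F1mul a F1zero = F1zero.
Proof. by rewrite F1mulC F1mul0. Qed.

Lemma F1hom_ext (B C : F1alg) (f g : F1hom B C) : f =1 g -> f = g.
Proof.
case: f g => [f f1 fM f0] [g g1 gM g0] /= /funext efg; subst g.
by congr F1Hom; exact: Prop_irrelevance.
Qed.

Definition F1hom_id (B : F1alg) : F1hom B B :=
  F1Hom (F1fun := id) erefl (fun _ _ => erefl) erefl.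

Variables B C D : F1alg.
Variables (g : F1hom C D) (f : F1hom B C).

Fact F1comp1 : (g \o f) F1one = F1one.
Proof. by rewrite /= !F1hom1. Qed.

Fact F1compM a b : (g \o f) (F1mul a b) = F1mul ((g \o f) a) ((g \o f) b).
Proof. by rewrite /= !F1homM. Qed.

Fact F1comp0 : (g \o f) F1zero = F1zero.
Proof. by rewrite /= !F1hom0. Qed.

Definition F1hom_comp : F1hom B D := F1Hom F1comp1 F1compM F1comp0.

End F1Theory.

Definition F1mult (A : comPzSemiRingType) : F1alg :=
  @F1Alg A *%R 1 0 (@mulrA A) (@mulrC A) (@mul1r A) (@mul0r A).

Section F1poly.
Variable n : nat.

(* [Some m] is the monomial with exponent vector [m], [None] is zero. *)
Definition F1poly_mul (a b : option {ffun 'I_n -> nat}) :=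
  match a, b with Some m, Some m' => Some (m + m') | _, _ => None end.

Fact F1poly_mulA : associative F1poly_mul.
Proof. by move=> [x|] [y|] [z|] //=; rewrite addrA. Qed.

Fact F1poly_mulC : commutative F1poly_mul.
Proof. by move=> [x|] [y|] //=; rewrite addrC. Qed.

Fact F1poly_mul1 : left_id (Some 0) F1poly_mul.
Proof. by case=> //= x; rewrite add0r. Qed.

Fact F1poly_mul0 : left_zero None F1poly_mul.
Proof. by []. Qed.

Definition F1poly : F1alg :=
  F1Alg F1poly_mulA F1poly_mulC F1poly_mul1 F1poly_mul0.

Lemma F1poly_integral : F1integral F1poly.
Proof.
split=> //; first by case=> [a|] [b|].
case=> [a|] [b|] [c|] //= _ _ _ [] /ffunP abc; congr Some; apply/ffunP => i.
by have := abc i; rewrite !ffunE => /eqP; rewrite eqn_add2l => /eqP.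
Qed.

End F1poly.

(* Since the only relations between the generators [x_b] are those of [B]
   together with [x_0 = 0], the [x_b] with [b <> 0] form an [S]-basis; an
   element is stored as its coefficient function in this basis, extended by 0 at
   [b = 0]. *)
Record tens (B : F1alg) (S : comPzSemiRingType) := Tens {
  coef :> {fsfun B -> S with 0};
  _ : coef F1zero == 0
}.

Section Tens.
Variables (B : F1alg) (S : comPzSemiRingType).
Local Notation BS := (tens B S).
Implicit Types (f g : BS) (b : B) (r s : S).

HB.instance Definition _ := [isSub for @coef B S].
HB.instance Definition _ := [Choice of BS by <:].

Lemma coefz f : f F1zero = 0.
Proof. by case: f => f /= /eqP. Qed.

Lemma tensP f g : f =1 g -> f = g.
Proof. by move=> fg; apply/val_inj/fsfunP. Qed.

Fact tens0_subproof : ([fsfun] : {fsfun B -> S with 0}) F1zero == 0.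
Proof. by rewrite fsfunE. Qed.
Definition tens0 : BS := Tens tens0_subproof.

Definition tens_add_fun f g : {fsfun B -> S with 0} :=
  [fsfun b in (finsupp f `|` finsupp g)%fset => f b + g b].

Lemma tens_add_funE f g b : tens_add_fun f g b = f b + g b.
Proof.
rewrite fsfunE inE; case: finsuppP => //= _; case: finsuppP => //= _.
by rewrite addr0.
Qed.

Fact tens_add_subproof f g : tens_add_fun f g F1zero == 0.
Proof. by rewrite tens_add_funE !coefz addr0. Qed.
Definition tens_add f g : BS := Tens (tens_add_subproof f g).

Fact tens_addA : associative tens_add.
Proof. by move=> f g h; apply/tensP => b; rewrite !tens_add_funE addrA. Qed.

Fact tens_addC : commutative tens_add.
Proof. by move=> f g; apply/tensP => b; rewrite !tens_add_funE addrC. Qed.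

Fact tens_add0 : left_id tens0 tens_add.
Proof.
by move=> f; apply/tensP => b; rewrite tens_add_funE /= fsfunE add0r.
Qed.

HB.instance Definition _ := GRing.isNmodule.Build BS
  tens_addA tens_addC tens_add0.

Lemma coef0 b : (0 : BS) b = 0.
Proof. by rewrite /= fsfunE. Qed.

Lemma coefD f g b : (f + g) b = f b + g b.
Proof. exact: tens_add_funE. Qed.

Definition mono_fun b r : {fsfun B -> S with 0} :=
  [fsfun x in [fset b]%fset => if b == F1zero then 0 else r].

Fact mono_subproof b r : mono_fun b r F1zero == 0.
Proof.
by rewrite fsfunE inE; case: (eqVneq F1zero b) => // <-; rewrite eqxx.
Qed.

(* The term [r x_b]; it vanishes for [b = 0]. *)
Definition mono b r : BS := Tens (mono_subproof b r).

Lemma coef_mono b r x :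
  mono b r x = if (x == b) && (b != F1zero) then r else 0.
Proof.
by rewrite /= fsfunE inE; case: eqP => //= _; case: eqP.
Qed.

Lemma monoD b r s : mono b (r + s) = mono b r + mono b s.
Proof.
apply/tensP => x; rewrite coefD !coef_mono; case: ifP => // _.
by rewrite addr0.
Qed.

Lemma mono0 b : mono b 0 = 0.
Proof. by apply/tensP => x; rewrite coef_mono coef0 if_same. Qed.

Lemma monoz r : mono F1zero r = 0.
Proof. by apply/tensP => x; rewrite coef_mono coef0 eqxx andbF. Qed.

Section Extend.
Variables (V : nmodType) (F : B -> S -> V).

Definition tens_ext f : V := \sum_(b <- finsupp f) F b (f b).

Hypothesis F0 : forall b, F b 0 = 0.

Lemma tens_ext_big (E : {fset B}) f : (finsupp f `<=` E)%fset ->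
  tens_ext f = \sum_(b <- E) F b (f b).
Proof.
move=> fE; rewrite /tens_ext (big_fset_incl _ fE) // => b _ bf.
by rewrite fsfun_dflt.
Qed.

Hypothesis FD : forall b r s, F b (r + s) = F b r + F b s.

Lemma tens_ext0 : tens_ext 0 = 0.
Proof. by rewrite /tens_ext big1 // => b _; rewrite coef0. Qed.

Lemma tens_extD f g : tens_ext (f + g) = tens_ext f + tens_ext g.
Proof.
pose E := (finsupp (f + g)%R `|` (finsupp f `|` finsupp g))%fset.
rewrite !(@tens_ext_big E) /E ?fsubsetUl //.
- by rewrite -big_split /=; apply: eq_bigr => b _; rewrite tens_add_funE FD.
- by apply: fsubsetU; rewrite fsubsetUr orbT.
- by apply: fsubsetU; rewrite fsubsetUl orbT.
Qed.

Hypothesis Fz : forall r, F F1zero r = 0.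

Lemma tens_ext_mono b r : tens_ext (mono b r) = F b r.
Proof.
have [->|b0] := eqVneq b F1zero; first by rewrite monoz tens_ext0 Fz.
rewrite (@tens_ext_big [fset b]%fset); last first.
  by apply/fsubsetP => x; rewrite mem_finsupp coef_mono inE; case: (x == b);
    rewrite //= eqxx.
by rewrite big_seq_fset1 coef_mono eqxx b0.
Qed.

End Extend.

Lemma coef_sum (I : Type) (r : seq I) (F : I -> BS) b :
  (\sum_(i <- r) F i) b = \sum_(i <- r) F i b.
Proof.
by elim: r => [|i r IH]; rewrite ?big_nil ?coef0 // !big_cons coefD IH.
Qed.

Lemma tens_decomp f : f = \sum_(b <- finsupp f) mono b (f b).
Proof.
apply/tensP => x; rewrite coef_sum.
have [xf|xf] := boolP (x \in finsupp f); last first.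
  rewrite (fsfun_dflt xf) big1_seq // => b /andP[_ bf]; rewrite coef_mono.
  by case: eqP => //= xb; rewrite xb bf in xf.
rewrite (big_fsetD1 x) //= coef_mono eqxx /=.
rewrite big1_seq ?addr0 => [|b /andP[_]]; last first.
  by rewrite !inE coef_mono eq_sym => /andP[/negPf -> _].
by case: eqP => //= x0; rewrite x0 coefz.
Qed.

Lemma tens_ind (P : BS -> Prop) : P 0 ->
  (forall f g, P f -> P g -> P (f + g)) ->
  (forall b r, P (mono b r)) -> forall f, P f.
Proof.
by move=> P0 PD PX f; rewrite (tens_decomp f); elim/big_ind: _ => // b _.
Qed.

Definition tens_mul f g : BS :=
  tens_ext (fun a r => tens_ext (fun b s => mono (F1mul a b) (r * s)) g) f.

Fact inner0 a r : (fun b s => mono (F1mul a b) (r * s)) ^~ 0 =1 fun=> 0.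
Proof. by move=> b /=; rewrite mulr0 mono0. Qed.

Fact innerD a r b s t : mono (F1mul a b) (r * (s + t)) =
  mono (F1mul a b) (r * s) + mono (F1mul a b) (r * t).
Proof. by rewrite mulrDr monoD. Qed.

Fact outer0 g a : tens_ext (fun b s => mono (F1mul a b) (0 * s)) g = 0.
Proof. by rewrite /tens_ext big1 // => b _; rewrite mul0r mono0. Qed.

Fact outerD g a r s :
  tens_ext (fun b t => mono (F1mul a b) ((r + s) * t)) g =
  tens_ext (fun b t => mono (F1mul a b) (r * t)) g +
  tens_ext (fun b t => mono (F1mul a b) (s * t)) g.
Proof.
by rewrite /tens_ext -big_split; apply: eq_bigr => b _; rewrite mulrDl monoD.
Qed.

Fact tens_mulDl : left_distributive tens_mul +%R.
Proof.
move=> f g h; rewrite /tens_mul tens_extD //; first exact: outer0.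
exact: outerD.
Qed.

Fact tens_mul0l : left_zero 0 tens_mul.
Proof. by move=> f; exact: (tens_ext0 (@outer0 f)). Qed.

Fact tens_mulDr : right_distributive tens_mul +%R.
Proof.
move=> f g h; rewrite /tens_mul /tens_ext -big_split /=; apply: eq_bigr => a _.
exact: (tens_extD (@inner0 a (f a)) (@innerD a (f a))).
Qed.

Fact tens_mul0r : right_zero 0 tens_mul.
Proof.
move=> f; rewrite /tens_mul /tens_ext big1 // => a _.
by rewrite big1 // => b _; rewrite coef0 mulr0 mono0.
Qed.

Fact tens_mul_mono a b r s :
  tens_mul (mono a r) (mono b s) = mono (F1mul a b) (r * s).
Proof.
rewrite /tens_mul tens_ext_mono => [|c|t].
- by rewrite tens_ext_mono => // t; rewrite ?F1mulr0 ?monoz // mulr0 mono0.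
- exact: outer0.
- by rewrite /tens_ext big1 // => c _; rewrite F1mul0 monoz.
Qed.

Fact tens_mulC : commutative tens_mul.
Proof.
move=> f g; elim/tens_ind: f => [|f f' IH IH'|a r].
- by rewrite tens_mul0l tens_mul0r.
- by rewrite tens_mulDl tens_mulDr IH IH'.
elim/tens_ind: g => [|f f' IH IH'|b s].
- by rewrite tens_mul0l tens_mul0r.
- by rewrite tens_mulDl tens_mulDr IH IH'.
by rewrite !tens_mul_mono F1mulC mulrC.
Qed.

Fact tens_mulA : associative tens_mul.
Proof.
move=> f g h; elim/tens_ind: f => [|f f' IH IH'|a r].
- by rewrite !tens_mul0l.
- by rewrite !tens_mulDl IH IH'.
elim/tens_ind: g => [|f f' IH IH'|b s].
- by rewrite !(tens_mul0l, tens_mul0r).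
- by rewrite !(tens_mulDl, tens_mulDr) IH IH'.
elim/tens_ind: h => [|f f' IH IH'|c t].
- by rewrite !tens_mul0r.
- by rewrite !tens_mulDr IH IH'.
by rewrite !tens_mul_mono F1mulA mulrA.
Qed.

Fact tens_mul1 : left_id (mono F1one 1) tens_mul.
Proof.
elim/tens_ind => [|f f' IH IH'|a r].
- by rewrite tens_mul0r.
- by rewrite tens_mulDr IH IH'.
by rewrite tens_mul_mono F1mul1 mul1r.
Qed.

Fact tens_mul1r : right_id (mono F1one 1) tens_mul.
Proof. by move=> f; rewrite tens_mulC tens_mul1. Qed.

HB.instance Definition _ := GRing.Nmodule_isPzSemiRing.Build BS
  tens_mulA tens_mul1 tens_mul1r tens_mulDl tens_mulDr tens_mul0l tens_mul0r.
HB.instance Definition _ :=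
  GRing.PzSemiRing_hasCommutativeMul.Build BS tens_mulC.

Lemma mono_mul a b r s : mono a r * mono b s = mono (F1mul a b) (r * s).
Proof. exact: tens_mul_mono. Qed.

Definition tens_const r : BS := mono F1one r.

Fact tens_const_nmod : nmod_morphism tens_const.
Proof. by split=> [|r s]; rewrite /tens_const ?mono0 ?monoD. Qed.

Fact tens_const_monoid : monoid_morphism tens_const.
Proof. by split=> [//|r s]; rewrite /tens_const mono_mul F1mul1. Qed.

HB.instance Definition _ :=
  GRing.isNmodMorphism.Build S BS tens_const tens_const_nmod.
HB.instance Definition _ :=
  GRing.isMonoidMorphism.Build S BS tens_const tens_const_monoid.

Definition tensAlg : cAlg S := CAlg tens_const.

Definition del_term b f : BS :=
  tens_ext (fun c r => if c == b then 0 else mono c r) f.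

Lemma coef_del_term b f c : del_term b f c = if c == b then 0 else f c.
Proof.
rewrite {2}(tens_decomp f) coef_sum coef_sum.
have [->|cb] := eqVneq c b.
  rewrite big1 // => d _; have [_|db] := eqVneq d b; first exact: coef0.
  by rewrite coef_mono eq_sym (negPf db).
apply: eq_bigr => d _; have [->|//] := eqVneq d b.
by rewrite coef0 coef_mono (negPf cb).
Qed.

End Tens.

Arguments mono {B S} b r.
Arguments del_term {B S} b f.

(* [tens_lift] and [tens_lift_uniq] confirm that [tens] is generated by the
   [x_b] subject only to the relations of [B]. *)
Section Lift.
Variables (B : F1alg) (S : comPzSemiRingType) (A : cAlg S).
Variable u : F1hom B (F1mult A).

Definition lift_fun (f : tens B S) : A :=
  tens_ext (fun b r => alg_str A r * (u b : A)) f.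

Fact lift_funD : nmod_morphism lift_fun.
Proof.
split=> [|f g].
  by rewrite /lift_fun tens_ext0 // => b; rewrite rmorph0 mul0r.
by rewrite /lift_fun tens_extD => [//|b|b r s];
  rewrite ?rmorph0 ?mul0r // rmorphD mulrDl.
Qed.

Lemma lift_mono b r : lift_fun (mono b r) = alg_str A r * (u b : A).
Proof.
rewrite /lift_fun tens_ext_mono => [//|c|s].
- by rewrite rmorph0 mul0r.
- by rewrite F1hom0 /= mulr0.
Qed.

Fact lift_funM : monoid_morphism lift_fun.
Proof.
have [l0 lD] := lift_funD.
split=> [|f g]; first by rewrite lift_mono rmorph1 F1hom1 mul1r.
elim/tens_ind: f => [|f f' IH IH'|a r].
- by rewrite mul0r l0 mul0r.
- by rewrite mulrDl !lD IH IH' mulrDl.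
elim/tens_ind: g => [|f f' IH IH'|b s].
- by rewrite mulr0 l0 mulr0.
- by rewrite mulrDr !lD IH IH' mulrDr.
by rewrite mono_mul !lift_mono rmorphM F1homM /= mulrACA.
Qed.

HB.instance Definition _ :=
  GRing.isNmodMorphism.Build (tens B S) A lift_fun lift_funD.
HB.instance Definition _ :=
  GRing.isMonoidMorphism.Build (tens B S) A lift_fun lift_funM.

Fact lift_funE r : lift_fun (alg_str (tensAlg B S) r) = alg_str A r.
Proof. by rewrite lift_mono F1hom1 /= mulr1. Qed.

Definition tens_lift : algHom (tensAlg B S) A :=
  @AlgHom S (tensAlg B S) A lift_fun lift_funE.

Lemma tens_liftE b : tens_lift (mono b 1) = u b.
Proof. by rewrite /= lift_mono rmorph1 mul1r. Qed.

Lemma tens_lift_uniq (g : algHom (tensAlg B S) A) :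
  (forall b, g (mono b 1) = u b) -> g = tens_lift.
Proof.
move=> gu; apply: algHom_ext => f; elim/tens_ind: f => [|f f' IH IH'|b r].
- by rewrite !rmorph0.
- by rewrite !rmorphD IH IH'.
have -> : mono b r = alg_str (tensAlg B S) r * mono b 1 :> tensAlg B S.
  by rewrite /= mono_mul F1mul1 mulr1.
by rewrite !rmorphM !alg_mapE gu tens_liftE.
Qed.

End Lift.

Section TensMap.
Variable S : comPzSemiRingType.

Section Gen.
Variables (B : F1alg) (A : cAlg S) (g : algHom (tensAlg B S) A).

Fact gen1 : (g (mono F1one 1) : F1mult A) = F1one.
Proof. exact: (rmorph1 g). Qed.

Fact genM a b : g (mono (F1mul a b) 1) =
  F1mul (g (mono a 1) : F1mult A) (g (mono b 1)).
Proof. by rewrite /= -(rmorphM g) /= mono_mul mulr1. Qed.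

Fact gen0 : (g (mono F1zero 1) : F1mult A) = F1zero.
Proof. by rewrite monoz rmorph0. Qed.

Definition tens_gen : F1hom B (F1mult A) :=
  F1Hom (F1fun := fun b => g (mono b 1) : F1mult A) gen1 genM gen0.

End Gen.

Definition tens_map (B C : F1alg) (h : F1hom B C) :
    algHom (tensAlg B S) (tensAlg C S) :=
  tens_lift (F1hom_comp (tens_gen (algHom_id (tensAlg C S))) h).

Lemma tens_map_mono (B C : F1alg) (h : F1hom B C) b r :
  tens_map h (mono b r) = mono (h b) r.
Proof. by rewrite /= lift_mono /= mono_mul F1mul1 mulr1. Qed.

Lemma tens_map_id (B : F1alg) : tens_map (F1hom_id B) = algHom_id _.
Proof. by apply/esym/tens_lift_uniq. Qed.

Lemma tens_map_comp (B C D : F1alg) (g : F1hom C D) (f : F1hom B C) :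
  tens_map (F1hom_comp g f) = algHom_comp (tens_map g) (tens_map f).
Proof.
apply/esym/tens_lift_uniq => b; rewrite [LHS]/= -/(tens_map f).
by rewrite [_ (mono b 1)]tens_map_mono [LHS]tens_map_mono.
Qed.

End TensMap.

Inductive congr (S : comPzSemiRingType) (E : S -> S -> Prop) : S -> S -> Prop :=
| congr_gen x y : E x y -> congr E x y
| congr_refl x : congr E x x
| congr_sym x y : congr E x y -> congr E y x
| congr_trans x y z : congr E x y -> congr E y z -> congr E x z
| congr_add x y x' y' : congr E x x' -> congr E y y' ->
    congr E (x + y) (x' + y')
| congr_mul x y x' y' : congr E x x' -> congr E y y' ->
    congr E (x * y) (x' * y').

Section Quotient.
Variables (S : comPzSemiRingType) (E : S -> S -> Prop).

Definition congrb : rel S := fun x y => `[< congr E x y >].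

Fact congrb_refl : reflexive congrb.
Proof. by move=> x; apply/asboolP/congr_refl. Qed.

Fact congrb_sym : symmetric congrb.
Proof.
by move=> x y; apply/asboolP/asboolP => /congr_sym.
Qed.

Fact congrb_trans : transitive congrb.
Proof.
by move=> y x z /asboolP xy /asboolP yz; apply/asboolP; apply: congr_trans yz.
Qed.

Canonical congr_equiv := EquivRel congrb congrb_refl congrb_sym congrb_trans.

Definition congr_quot := {eq_quot congr_equiv}.
HB.instance Definition _ := Choice.on congr_quot.
HB.instance Definition _ : EqQuotient S congr_equiv congr_quot :=
  EqQuotient.on congr_quot.

Definition cls (x : S) : congr_quot := \pi_congr_quot x.

Lemma clsP x y : cls x = cls y <-> congr E x y.
Proof.
split=> [/eqquotP /asboolP //|xy].
by apply/eqquotP/asboolP.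
Qed.

Lemma cls_reprK x : cls (repr x) = x.
Proof. exact: reprK. Qed.

Lemma cls_repr x : congr E (repr (cls x)) x.
Proof. by apply/clsP; rewrite cls_reprK. Qed.

Definition quot_add (x y : congr_quot) := cls (repr x + repr y).
Definition quot_mul (x y : congr_quot) := cls (repr x * repr y).

Fact quot_addE x y : quot_add (cls x) (cls y) = cls (x + y).
Proof. by apply/clsP/congr_add; apply: cls_repr. Qed.

Fact quot_mulE x y : quot_mul (cls x) (cls y) = cls (x * y).
Proof. by apply/clsP/congr_mul; apply: cls_repr. Qed.

Lemma quot_ind (P : congr_quot -> Prop) :
  (forall x, P (cls x)) -> forall x, P x.
Proof. by move=> PC x; rewrite -(cls_reprK x). Qed.

Fact quot_addA : associative quot_add.
Proof. by do 3![elim/quot_ind=> ?]; rewrite !quot_addE addrA. Qed.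

Fact quot_addC : commutative quot_add.
Proof. by do 2![elim/quot_ind=> ?]; rewrite !quot_addE addrC. Qed.

Fact quot_add0 : left_id (cls 0) quot_add.
Proof. by elim/quot_ind=> ?; rewrite quot_addE add0r. Qed.

HB.instance Definition _ := GRing.isNmodule.Build congr_quot
  quot_addA quot_addC quot_add0.

Fact cls_addE x y : cls x + cls y = cls (x + y).
Proof. exact: quot_addE. Qed.

Fact quot_mulA : associative quot_mul.
Proof. by do 3![elim/quot_ind=> ?]; rewrite !quot_mulE mulrA. Qed.

Fact quot_mulC : commutative quot_mul.
Proof. by do 2![elim/quot_ind=> ?]; rewrite !quot_mulE mulrC. Qed.

Fact quot_mul1 : left_id (cls 1) quot_mul.
Proof. by elim/quot_ind=> ?; rewrite quot_mulE mul1r. Qed.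

Fact quot_mul1r : right_id (cls 1) quot_mul.
Proof. by elim/quot_ind=> ?; rewrite quot_mulE mulr1. Qed.

Fact quot_mulD : left_distributive quot_mul +%R.
Proof.
by do 3![elim/quot_ind=> ?]; rewrite !(quot_mulE, cls_addE) mulrDl.
Qed.

Fact quot_mulDr : right_distributive quot_mul +%R.
Proof.
by do 3![elim/quot_ind=> ?]; rewrite !(quot_mulE, cls_addE) mulrDr.
Qed.

Fact quot_mul0 : left_zero (cls 0) quot_mul.
Proof. by elim/quot_ind=> ?; rewrite quot_mulE mul0r. Qed.

Fact quot_mul0r : right_zero (cls 0) quot_mul.
Proof. by elim/quot_ind=> ?; rewrite quot_mulE mulr0. Qed.

HB.instance Definition _ := GRing.Nmodule_isPzSemiRing.Build congr_quot
  quot_mulA quot_mul1 quot_mul1r quot_mulD quot_mulDr quot_mul0 quot_mul0r.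
HB.instance Definition _ :=
  GRing.PzSemiRing_hasCommutativeMul.Build congr_quot quot_mulC.

Fact cls_nmod : nmod_morphism cls.
Proof. by split=> // x y; rewrite -quot_addE. Qed.

Fact cls_monoid : monoid_morphism cls.
Proof. by split=> // x y; rewrite -quot_mulE. Qed.

HB.instance Definition _ :=
  GRing.isNmodMorphism.Build S congr_quot cls cls_nmod.
HB.instance Definition _ :=
  GRing.isMonoidMorphism.Build S congr_quot cls cls_monoid.

End Quotient.

Section QuotAlg.
Variables (S : comPzSemiRingType) (A : cAlg S) (E : A -> A -> Prop).

Definition quotAlg : cAlg S := @CAlg S (congr_quot E) (@cls A E \o alg_str A).

Definition quot_pi : algHom A quotAlg :=
  @AlgHom S A quotAlg (@cls A E) (fun _ => erefl).

Variables (C : cAlg S) (g : algHom A C).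
Hypothesis gE : forall x y, E x y -> g x = g y.

Lemma congr_hom x y : congr E x y -> g x = g y.
Proof.
elim=> // [{}x {}y z _ -> _ -> //|a b a' b' _ e _ e'|a b a' b' _ e _ e'].
  by rewrite !rmorphD e e'.
by rewrite !rmorphM e e'.
Qed.

Definition quot_lift_fun (x : quotAlg) : C := g (repr x).

Lemma quot_lift_cls x : quot_lift_fun (cls E x) = g x.
Proof. by apply/congr_hom/cls_repr. Qed.

Fact quot_lift_nmod : nmod_morphism quot_lift_fun.
Proof.
split=> [|x y]; first by rewrite -(rmorph0 (@cls A E)) quot_lift_cls rmorph0.
by elim/quot_ind: x => x; elim/quot_ind: y => y;
  rewrite -rmorphD !quot_lift_cls rmorphD.
Qed.

Fact quot_lift_monoid : monoid_morphism quot_lift_fun.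
Proof.
split=> [|x y]; first by rewrite -(rmorph1 (@cls A E)) quot_lift_cls rmorph1.
by elim/quot_ind: x => x; elim/quot_ind: y => y;
  rewrite -rmorphM !quot_lift_cls rmorphM.
Qed.

HB.instance Definition _ :=
  GRing.isNmodMorphism.Build quotAlg C quot_lift_fun quot_lift_nmod.
HB.instance Definition _ :=
  GRing.isMonoidMorphism.Build quotAlg C quot_lift_fun quot_lift_monoid.

Fact quot_lift_str r : quot_lift_fun (alg_str quotAlg r) = alg_str C r.
Proof. by rewrite quot_lift_cls alg_mapE. Qed.

Definition quot_lift : algHom quotAlg C :=
  @AlgHom S quotAlg C quot_lift_fun quot_lift_str.

Lemma quot_liftE x : quot_lift (quot_pi x) = g x.
Proof. exact: quot_lift_cls. Qed.

End QuotAlg.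

Lemma quot_hom_ext (S : comPzSemiRingType) (A : cAlg S) (E : A -> A -> Prop)
    (C : cAlg S) (f g : algHom (quotAlg E) C) :
  (forall x, f (quot_pi E x) = g (quot_pi E x)) -> f = g.
Proof. by move=> fg; apply: algHom_ext; elim/quot_ind. Qed.

Inductive ideal_span (S : comPzSemiRingType) (E : S -> Prop) : S -> Prop :=
| ideal_gen x : E x -> ideal_span E x
| ideal_zero : ideal_span E 0
| ideal_add x y : ideal_span E x -> ideal_span E y -> ideal_span E (x + y)
| ideal_mul a x : ideal_span E x -> ideal_span E (a * x).

(* A surjection from [B (x)_F1 k] onto [A], with [B] integral. *)
Record embedding (k : comPzSemiRingType) (A : cAlg k) := Embedding {
  emb_mon : F1alg;
  emb_int : F1integral emb_mon;
  emb_map : algHom (tensAlg emb_mon k) A;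
  emb_surj : forall a, exists f, emb_map f = a
}.

Section Trop.
Variables (R : realType) (k : fieldType) (nu : valuation k R).
Local Notation T := (tropical R).

Section TropDef.
Variable B : F1alg.

Definition tens_val_fun (f : tens B k) : {fsfun B -> T with 0} :=
  [fsfun b in finsupp f => nu (f b)].

Lemma tens_val_funE f b : tens_val_fun f b = nu (f b).
Proof.
by rewrite fsfunE; case: finsuppP => //= _; rewrite val0.
Qed.

Fact tens_val_subproof f : tens_val_fun f F1zero == 0.
Proof. by rewrite tens_val_funE coefz val0. Qed.

Definition tens_val f : tens B T := Tens (tens_val_subproof f).

Definition bend (I : tens B T -> Prop) (g g' : tens B T) : Prop :=
  exists b, [/\ I g, b \in finsupp g & g' = del_term b g].

Variables (A : cAlg k) (psi : algHom (tensAlg B k) A).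

Definition trop_ker : tens B T -> Prop :=
  ideal_span (fun g => exists f : tens B k, psi f = 0 /\ g = tens_val f).

End TropDef.

Definition trop_alg (A : cAlg k) (phi : embedding A) : cAlg T :=
  quotAlg (A := tensAlg (emb_mon phi) T) (bend (trop_ker (emb_map phi))).

Lemma trop_addxx (x : T) : x + x = x.
Proof. by case: x => [x|] //=; congr Some; exact: minxx. Qed.

Lemma trop_total (x y : T) : x + y = x \/ x + y = y.
Proof.
case: x y => [x|] [y|]; [|by left|by right|by left].
by have [xy|yx] := leP x y; [left|right]; congr Some;
  [apply/min_idPl|apply/min_idPr/ltW].
Qed.

Lemma val_strict (a b : k) : nu a + nu b = nu a -> nu a <> nu b ->
  nu (a + b) = nu a.
Proof.
move=> ab nab; have := valD nu a b; rewrite ab => sa.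
have := valD nu (a + b) (- b); rewrite addrK -(mulN1r b) valM valN1 mul1r.
rewrite addrA [nu a + _]addrC sa ab => sb.
by case: (trop_total (nu (a + b)) (nu b)); rewrite -sb.
Qed.

Lemma val_sum (I : Type) (s : seq I) (F : I -> k) :
  nu (\sum_(i <- s) F i) + \sum_(i <- s) nu (F i) = \sum_(i <- s) nu (F i).
Proof.
elim: s => [|i s IH]; first by rewrite !big_nil val0 addr0.
rewrite !big_cons; set a := F i; set b := \sum_(j <- s) F j in IH *.
by rewrite -IH [nu a + _]addrA addrA valD.
Qed.

Section TensFacts.
Variables (B : F1alg) (S : comPzSemiRingType).
Implicit Types f g : tens B S.

Lemma del_termD b f g : del_term b (f + g) = del_term b f + del_term b g.
Proof.
apply/tensP => c; rewrite !(coefD, coef_del_term).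
by case: eqP; rewrite ?addr0.
Qed.

Lemma del_term0 b : del_term b (0 : tens B S) = 0.
Proof. by apply/tensP => c; rewrite !(coef0, coef_del_term) if_same. Qed.

Lemma del_term_mono b c r :
  del_term b (mono c r : tens B S) = if c == b then 0 else mono c r.
Proof.
apply/tensP => x; rewrite coef_del_term coef_mono.
have [->|cb] := eqVneq c b; first by rewrite coef0; case: eqP.
rewrite coef_mono; have [->|//] := eqVneq x b.
by rewrite eq_sym (negPf cb).
Qed.

Lemma del_term_id b f : b \notin finsupp f -> del_term b f = f.
Proof.
move=> bf; apply/tensP => c; rewrite coef_del_term.
by case: eqP => // ->; rewrite fsfun_dflt.
Qed.

Lemma del_termK b f : f = del_term b f + mono b (f b).
Proof.
apply/tensP => c; rewrite coefD coef_del_term coef_mono.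
have [->|cb] := eqVneq c b; last by rewrite addr0.
by rewrite add0r; case: eqP => //= ->; rewrite coefz.
Qed.

Lemma del_term_mulmono (intB : F1integral B) d t b0 :
  (exists b, forall g, del_term b0 (mono d t * g) = mono d t * del_term b g) \/
  (forall g, del_term b0 (mono d t * g) = mono d t * g).
Proof.
have [->|d0] := eqVneq d F1zero.
  by right=> g; rewrite monoz mul0r del_term0.
have [->|b00] := eqVneq b0 F1zero.
  by right=> g; apply: del_term_id; rewrite mem_finsupp coefz eqxx.
have [[b db]|ndb] := pselect (exists b, F1mul d b = b0); last first.
  right=> g; elim/tens_ind: g => [|f g IH IH'|b s].
  - by rewrite mulr0 del_term0.
  - by rewrite mulrDr del_termD IH IH'.
  by rewrite mono_mul del_term_mono; case: eqP => // e; case: ndb; exists b.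
left; exists b => g; elim/tens_ind: g => [|f g IH IH'|c s].
- by rewrite !(mulr0, del_term0).
- by rewrite !(mulrDr, del_termD) IH IH'.
rewrite mono_mul !del_term_mono; have [->|cb] := eqVneq c b.
  by rewrite db eqxx mulr0.
case: eqP => [dc|_]; last by rewrite mono_mul.
case/eqP: cb; apply: (F1int_cancel intB (a := d)); first exact/eqP.
- by move=> c0; move: b00; rewrite -dc c0 F1mulr0 eqxx.
- by move=> c0; move: b00; rewrite -db c0 F1mulr0 eqxx.
- by rewrite dc db.
Qed.

End TensFacts.

Lemma tens_val_del_term (B : F1alg) b (f : tens B k) :
  tens_val (del_term b f) = del_term b (tens_val f).
Proof.
apply/tensP => c; rewrite !(coef_del_term, tens_val_funE).
by case: eqP; rewrite ?val0 // tens_val_funE.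
Qed.

Lemma coef_tens_map (S : comPzSemiRingType) (B C : F1alg)
    (h : F1hom B C) (f : tens B S) (E : {fset B}) c :
  (finsupp f `<=` E)%fset ->
  tens_map S h f c = \sum_(b <- E) mono (h b) (f b) c.
Proof.
move=> fE; rewrite {1}(tens_decomp f) (raddf_sum (tens_map S h)) coef_sum.
rewrite (big_fset_incl _ fE) /=; last first.
  move=> b _ bf; have -> : f b = 0 by exact: fsfun_dflt.
  by rewrite mono0 raddf0 coef0.
by apply: eq_bigr => b _; rewrite tens_map_mono.
Qed.

Lemma tens_val_map (B C : F1alg) (h : F1hom B C) (f : tens B k) c :
  tens_val (tens_map k h f) c + tens_map T h (tens_val f) c
  = tens_map T h (tens_val f) c.
Proof.
rewrite tens_val_funE (coef_tens_map h c (fsubset_refl (finsupp f))).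
rewrite (@coef_tens_map _ _ _ h (tens_val f) (finsupp f)); last first.
  apply/fsubsetP => b; rewrite !mem_finsupp tens_val_funE.
  by apply: contra => /eqP ->; rewrite val0.
suff e : \sum_(b <- finsupp f) mono (h b) (tens_val f b) c =
    \sum_(b <- finsupp f) nu (mono (h b) (f b) c) by rewrite e val_sum.
apply: eq_bigr => b _; rewrite !coef_mono tens_val_funE.
by case: ifP; rewrite ?val0.
Qed.

Lemma bend_map (B C : F1alg) (h : F1hom B C) (f : tens B k) b0
    (E : tens C T -> tens C T -> Prop) :
  (forall c, congr E (tens_val (tens_map k h f))
                     (del_term c (tens_val (tens_map k h f)))) ->
  congr E (tens_map T h (tens_val f)) (tens_map T h (del_term b0 (tens_val f))).
Proof.
set v := tens_val _ => vE; set G := tens_map T h _.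
pose D := del_term b0 (tens_val f); rewrite -/D.
pose c0 := h b0; pose r := nu (f b0); pose r' := tens_map T h D c0.
have GE : G = tens_map T h D + mono c0 r.
  rewrite /G {1}(del_termK b0 (tens_val f)) rmorphD -/D; congr (_ + _).
  by rewrite tens_map_mono tens_val_funE.
have [c00|c00] := eqVneq c0 F1zero.
  by rewrite GE c00 monoz addr0; exact: congr_refl.
have [r'r|r'r] := trop_total r' r.
  rewrite GE (_ : _ + _ = tens_map T h D); first exact: congr_refl.
  apply/tensP => c; rewrite coefD coef_mono c00 andbT.
  by case: eqP => [->|_]; rewrite ?addr0.
have [rr'|/eqP rr'] := eqVneq r' r.
  rewrite GE (_ : _ + _ = tens_map T h D); first exact: congr_refl.
  apply/tensP => c; rewrite coefD coef_mono c00 andbT.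
  by case: eqP => [->|_]; rewrite ?addr0 // -/r' -rr' trop_addxx.
have Gc0 : G c0 = r by rewrite GE coefD coef_mono eqxx c00.
have vc0 : v c0 = r.
  rewrite /v tens_val_funE {1}(del_termK b0 f) rmorphD coefD.
  rewrite tens_map_mono.
  rewrite coef_mono eqxx c00 addrC; set a := tens_map k h _ c0.
  have ar' : nu a + r' = r'.
    have := tens_val_map h (del_term b0 f) c0.
    by rewrite tens_val_funE tens_val_del_term.
  apply: val_strict; rewrite -/r.
    by rewrite addrC -{1}r'r addrA ar' r'r.
  by move=> ra; apply: rr'; rewrite -ar' -ra addrC.
have Gv c : v c + G c = G c by exact: tens_val_map.
pose u := del_term c0 G.
have GuE : G = u + v.
  apply/tensP => c; rewrite coefD coef_del_term.
  by case: eqP => [->|_]; rewrite ?add0r ?vc0 // addrC Gv.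
have uE : u + del_term c0 v = u.
  apply/tensP => c; rewrite coefD !coef_del_term.
  by case: eqP => // _; rewrite addrC Gv.
have Gu : congr E G u.
  rewrite {1}GuE -{2}uE.
  by apply: congr_add; [exact: congr_refl | exact: vE].
apply: congr_sym; rewrite (_ : tens_map T h D = u + mono c0 r'); last first.
  apply/tensP => c; rewrite coefD coef_del_term coef_mono c00 andbT.
  case: eqP => [->|/eqP cc]; first by rewrite add0r.
  by rewrite GE coefD coef_mono (negPf cc) !addr0.
have Gr' : G = G + mono c0 r'.
  apply/tensP => c; rewrite coefD coef_mono c00 andbT.
  by case: eqP => [->|_]; rewrite ?addr0 // Gc0 addrC.
rewrite [X in congr E _ X]Gr'.
by apply: congr_add; [exact: congr_sym | exact: congr_refl].
Qed.

End Trop.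
(* Schemes are presented by their functors of points: a scheme over [S] is a
   functor from [S]-algebras (the opposite of affine schemes) to sets which is a
   sheaf for coverings by basic open sets and is covered by open affine
   subfunctors; morphisms are natural transformations. *)
Section Schemes.
Variable S : comPzSemiRingType.
Implicit Types A B C : cAlg S.

Record sfunctor := SFunctor {
  pts :> cAlg S -> Type;
  sf_map : forall A B, algHom A B -> pts A -> pts B;
  sf_map_id : forall A (x : pts A), sf_map (algHom_id A) x = x;
  sf_map_comp : forall A B C (g : algHom B C) (f : algHom A B) (x : pts A),
    sf_map (algHom_comp g f) x = sf_map g (sf_map f x)
}.
Arguments sf_map s {A B} _ _.

Definition is_localization A B (f : A) (l : algHom A B) : Prop :=
  [/\ exists u, l f * u = 1,
      forall b, exists a n, b * l f ^+ n = l a &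
      forall a a', l a = l a' -> exists n, f ^+ n * a = f ^+ n * a'].

Definition unit_ideal A n (f : 'I_n -> A) : Prop :=
  exists s : 'I_n -> A, \sum_i s i * f i = 1.

(* The basic open sets of [f_0, ..., f_(n-1)] cover [Spec A] exactly when the
   [f_i] generate the unit ideal, and quasi-compactness makes finite families
   sufficient. *)
Definition zariski_sheaf (F : sfunctor) : Prop :=
  forall A n (f : 'I_n -> A) (B : 'I_n -> cAlg S) (C : 'I_n -> 'I_n -> cAlg S)
    (l : forall i, algHom A (B i))
    (p : forall i j, algHom (B i) (C i j))
    (q : forall i j, algHom (B j) (C i j)),
    unit_ideal f ->
    (forall i, is_localization (f i) (l i)) ->
    (forall i j, is_localization (f i * f j) (algHom_comp (p i j) (l i))) ->
    (forall i j, algHom_comp (p i j) (l i) = algHom_comp (q i j) (l j)) ->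
    forall x : forall i, F (B i),
    (forall i j, sf_map F (p i j) (x i) = sf_map F (q i j) (x j)) ->
    exists! y : F A, forall i, sf_map F (l i) y = x i.

Record subfunctor (F : sfunctor) := SubFunctor {
  sub_pts :> forall A, F A -> Prop;
  sub_map : forall A B (g : algHom A B) (x : F A),
    sub_pts x -> sub_pts (sf_map F g x)
}.

(* The restriction of [U] along any [x : Spec A -> F] is the open subscheme of
   [Spec A] which is the union of the basic open sets of the elements of [E]. *)
Definition open_sub (F : sfunctor) (U : subfunctor F) : Prop :=
  forall A (x : F A), exists E : A -> Prop,
    forall B (g : algHom A B), U B (sf_map F g x) <->
      exists n (e : 'I_n -> A), (forall i, E (e i)) /\ unit_ideal (g \o e).

Definition affine_sub (F : sfunctor) (U : subfunctor F) : Prop :=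
  exists C (u : F C), U C u /\
    forall A (x : F A), U A x -> exists! g : algHom C A, sf_map F g u = x.

Definition affine_cover (F : sfunctor) : Prop :=
  forall A (x : F A), exists n (f : 'I_n -> A) (B : 'I_n -> cAlg S)
    (l : forall i, algHom A (B i)),
    [/\ unit_ideal f,
        forall i, is_localization (f i) (l i) &
        forall i, exists U : subfunctor F,
          [/\ open_sub U, affine_sub U & U (B i) (sf_map F (l i) x)]].

Record scheme := Scheme {
  sch_fun :> sfunctor;
  sch_sheaf : zariski_sheaf sch_fun;
  sch_cover : affine_cover sch_fun
}.

Record schemeMor (X Y : scheme) := SchemeMor {
  mor :> forall A, X A -> Y A;
  mor_nat : forall A B (g : algHom A B) (x : X A),
    mor (sf_map X g x) = sf_map Y g (mor x)
}.

Lemma schemeMor_ext (X Y : scheme) (f g : schemeMor X Y) :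
  (forall A (x : X A), f A x = g A x) -> f = g.
Proof.
case: f g => [f fn] [g gn] /= fg.
have efg : f = g.
  by apply: functional_extensionality_dep => A; apply/funext => x; exact: fg.
by subst g; congr SchemeMor; exact: Prop_irrelevance.
Qed.

Definition schemeMor_id (X : scheme) : schemeMor X X :=
  @SchemeMor X X (fun _ x => x) (fun _ _ _ _ => erefl).

Fact schemeMor_comp_nat (X Y Z : scheme) (g : schemeMor Y Z)
    (f : schemeMor X Y) A B (h : algHom A B) (x : X A) :
  g B (f B (sf_map X h x)) = sf_map Z h (g A (f A x)).
Proof. by rewrite !mor_nat. Qed.

Definition schemeMor_comp (X Y Z : scheme) (g : schemeMor Y Z)
    (f : schemeMor X Y) : schemeMor X Z :=
  SchemeMor (schemeMor_comp_nat g f).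

Definition is_iso (X Y : scheme) (f : schemeMor X Y) : Prop :=
  exists g : schemeMor Y X,
    schemeMor_comp g f = schemeMor_id X /\ schemeMor_comp f g = schemeMor_id Y.

End Schemes.

Section Spec.
Variable S : comPzSemiRingType.
Implicit Types A B C D : cAlg S.

Fact Spec_fun_id D A (x : algHom D A) : algHom_comp (algHom_id A) x = x.
Proof. exact: algHom_ext. Qed.

Fact Spec_fun_comp D A B C (g : algHom B C) (f : algHom A B)
  (x : algHom D A) :
  algHom_comp (algHom_comp g f) x = algHom_comp g (algHom_comp f x).
Proof. exact: algHom_ext. Qed.

Definition Spec_fun D : sfunctor S :=
  SFunctor (pts := algHom D) (@Spec_fun_id D) (@Spec_fun_comp D).

Lemma expD_split (A : comPzSemiRingType) (x v : A) N :
  exists w, (x + v) ^+ N = x ^+ N + v * w.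
Proof.
elim: N => [|N [w IH]]; first by exists 0; rewrite mulr0 addr0.
exists (x ^+ N + x * w + v * w).
rewrite exprS IH mulrDl !mulrDr -exprS -!addrA (mulrCA x v).
by rewrite [v * (x * w) + _]addrCA.
Qed.

Lemma unit_ideal_exp A n (f : 'I_n -> A) N :
  unit_ideal f -> unit_ideal (fun i => f i ^+ N).
Proof.
move=> uf.
have H m : unit_ideal (fun i : 'I_n => if (i < m)%N then f i ^+ N else f i).
  elim: m => [//|m [s sE]].
  have [nm|mn] := leqP n m.
    exists s; rewrite -[RHS]sE; apply: eq_bigr => i _.
    by rewrite ltnS ltnW (leq_trans (ltn_ord i) nm).
  pose i0 := Ordinal mn; move: sE; rewrite (bigD1 i0) //= ltnn.
  set x := s i0 * f i0; set v := \sum_(i < n | _) _ => sE.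
  have [w wE] := expD_split x v N; move: wE; rewrite sE expr1n => wE.
  exists (fun i => if i == i0 then s i0 ^+ N else s i * w).
  rewrite (bigD1 i0) //= eqxx ltnSn -exprMn wE; congr (_ + _).
  rewrite mulr_suml; apply: eq_bigr => i ii0; rewrite (negPf ii0).
  rewrite ltnS leq_eqVlt (_ : (i == m :> nat) = false) 1?mulrAC //.
  by apply: contraNF ii0 => /eqP im; apply/eqP/val_inj.
have [s sE] := H n.
by exists s; rewrite -[RHS]sE; apply: eq_bigr => i _; rewrite ltn_ord.
Qed.

Lemma ord_bound n (P : 'I_n -> nat -> Prop) :
  (forall i a b, (a <= b)%N -> P i a -> P i b) ->
  (forall i, exists a, P i a) -> exists a, forall i, P i a.
Proof.
move=> Pm /choice[a aP]; exists (\max_i a i)%N => i.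
by apply: Pm (aP i); exact: leq_bigmax.
Qed.

Lemma cover_sep A n (f : 'I_n -> A) (B : 'I_n -> cAlg S)
    (l : forall i, algHom A (B i)) (a a' : A) :
  unit_ideal f -> (forall i, is_localization (f i) (l i)) ->
  (forall i, l i a = l i a') -> a = a'.
Proof.
move=> uf loc laa'.
have [N NP] : exists N, forall i, f i ^+ N * a = f i ^+ N * a'.
  apply: ord_bound => [i m m' mm' e|i].
    by rewrite -(subnK mm') exprD -!mulrA e.
  by have [_ _ /(_ _ _ (laa' i))] := loc i.
have [s sE] := unit_ideal_exp N uf.
rewrite -[a]mul1r -[a']mul1r -sE !mulr_suml; apply: eq_bigr => i _.
by rewrite -!mulrA NP.
Qed.

Lemma loc_cancel A B (f : A) (l : algHom A B) n b b' :
  is_localization f l -> l f ^+ n * b = l f ^+ n * b' -> b = b'.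
Proof.
case=> [[u uE] _ _] e.
have uN : u ^+ n * l f ^+ n = 1 by rewrite -exprMn mulrC uE expr1n.
by rewrite -[b]mul1r -[b']mul1r -uN -!mulrA e.
Qed.

Lemma cover_glue A n (f : 'I_n -> A) (B : 'I_n -> cAlg S)
    (C : 'I_n -> 'I_n -> cAlg S) (l : forall i, algHom A (B i))
    (p : forall i j, algHom (B i) (C i j))
    (q : forall i j, algHom (B j) (C i j)) (b : forall i, B i) :
  unit_ideal f -> (forall i, is_localization (f i) (l i)) ->
  (forall i j, is_localization (f i * f j) (algHom_comp (p i j) (l i))) ->
  (forall i j, algHom_comp (p i j) (l i) = algHom_comp (q i j) (l j)) ->
  (forall i j, p i j (b i) = q i j (b j)) ->
  exists a, forall i, l i a = b i.
Proof.
move=> uf loc loc2 pq pqb.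
have [m mP] : exists m, forall i, exists a, b i * l i (f i) ^+ m = l i a.
  apply: ord_bound => [i m m' mm' [a e]|i].
    exists (f i ^+ (m' - m) * a).
    by rewrite rmorphM rmorphXn -e mulrCA -exprD subnK.
  by have [_ /(_ (b i)) [a [m e]] _] := loc i; exists m, a.
have [a aP] := choice mP.
have [N NP] : exists N, forall ij : 'I_n * 'I_n,
    (f ij.1 * f ij.2) ^+ N * (f ij.2 ^+ m * a ij.1) =
    (f ij.1 * f ij.2) ^+ N * (f ij.1 ^+ m * a ij.2).
  suff [N NP] : exists N, forall k : 'I_#|{: 'I_n * 'I_n}|,
      let ij := enum_val k in
      (f ij.1 * f ij.2) ^+ N * (f ij.2 ^+ m * a ij.1) =
      (f ij.1 * f ij.2) ^+ N * (f ij.1 ^+ m * a ij.2).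
    by exists N => ij; have := NP (enum_rank ij); rewrite /= enum_rankK.
  apply: ord_bound => [k M M' MM' /= e|k /=].
    by rewrite -(subnK MM') exprD -!mulrA e.
  move: (enum_val k) => [i j] /=.
  have [_ _] := loc2 i j; apply.
  have lq x : q i j (l j x) = p i j (l i x).
    by have /(congr1 (fun h : algHom _ _ => h x)) /= := pq i j.
  rewrite /= !rmorphM !rmorphXn -(lq (a j)) -!aP !rmorphM !rmorphXn lq -pqb.
  by rewrite mulrCA [RHS]mulrCA; congr (_ * _); rewrite mulrC.
have [s sE] := unit_ideal_exp (N + m) uf.
exists (\sum_j s j * (f j ^+ N * a j)) => i.
apply: (loc_cancel (n := N + m) (loc i)).
rewrite -rmorphXn -rmorphM mulr_sumr.
rewrite (eq_bigr (fun j => s j * f j ^+ (N + m) * (f i ^+ N * a i)));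
  last first.
  move=> j _; rewrite mulrCA -mulrA; congr (_ * _).
  have := NP (j, i); rewrite /= !exprMn => e.
  by rewrite !exprD mulrACA [X in X * _ = _]mulrC e mulrACA.
rewrite -mulr_suml sE mul1r rmorphM -aP !rmorphXn exprD.
by rewrite -mulrA; congr (_ * _); rewrite mulrC.
Qed.

Lemma Spec_sheaf D : zariski_sheaf (Spec_fun D).
Proof.
move=> A n f B C l p q uf loc loc2 pq x xpq.
have /choice[y yP] : forall d : D, exists a, forall i, l i a = x i d.
  move=> d; apply: (cover_glue uf loc loc2 pq) => i j.
  by have /(congr1 (fun h : algHom _ _ => h d)) := xpq i j.
have sep a a' : (forall i, l i a = l i a') -> a = a' by exact: cover_sep loc.
have yD : nmod_morphism y.
  split=> [|d e]; apply: sep => i; first by rewrite yP !rmorph0.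
  by rewrite rmorphD !yP rmorphD.
have yM : monoid_morphism y.
  split=> [|d e]; apply: sep => i; first by rewrite yP !rmorph1.
  by rewrite rmorphM !yP rmorphM.
pose y1 := GRing.isNmodMorphism.Build D A y yD.
pose y2 := GRing.isMonoidMorphism.Build D A y yM.
pose yR : {rmorphism D -> A} := HB.pack y y1 y2.
have yE r : yR (alg_str D r) = alg_str A r.
  by apply: sep => i; rewrite yP !alg_mapE.
exists (AlgHom yE); split=> [i|z zP].
  by apply: algHom_ext => d; exact: yP.
apply: algHom_ext => d; apply: sep => i.
by have /(congr1 (fun h : algHom _ _ => h d)) /= -> := zP i; exact: yP.
Qed.

Fact full_sub_map (F : sfunctor S) A B (g : algHom A B) (x : F A) :
  True -> True.
Proof. by []. Qed.

Lemma Spec_cover D : affine_cover (Spec_fun D).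
Proof.
move=> A x; exists 1%N, (fun=> 1), (fun=> A), (fun=> algHom_id A); split.
- by exists (fun=> 1); rewrite big_ord1 mulr1.
- move=> _; split=> [|b|a a' /= aa']; last by exists 0%N; rewrite aa'.
    by exists 1; rewrite /= mulr1.
  by exists b, 0%N; rewrite mulr1.
move=> _; pose U := SubFunctor (sub_pts := fun A (_ : Spec_fun D A) => True)
  (@full_sub_map (Spec_fun D)).
exists U; split=> //.
  move=> A' y; exists (fun=> True) => B g; split=> // _.
  exists 1%N, (fun=> 1); split=> //; exists (fun=> 1).
  by rewrite big_ord1 /= rmorph1 mulr1.
exists D, (algHom_id D); split=> // A' y _; exists y; split.
  exact: algHom_ext.
by move=> g <-; exact: algHom_ext.
Qed.

Definition Spec D : scheme S := Scheme (@Spec_sheaf D) (@Spec_cover D).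

Definition Spec_map D E (h : algHom D E) : schemeMor (Spec E) (Spec D) :=
  @SchemeMor S (Spec E) (Spec D) (fun A (x : algHom E A) => algHom_comp x h)
    (fun A B g x => Spec_fun_comp g x h).

Lemma Spec_map_id D : Spec_map (algHom_id D) = schemeMor_id (Spec D).
Proof. by apply: schemeMor_ext => A x; exact: algHom_ext. Qed.

Lemma Spec_map_comp D E F (g : algHom E F) (f : algHom D E) :
  Spec_map (algHom_comp g f) = schemeMor_comp (Spec_map f) (Spec_map g).
Proof. by apply: schemeMor_ext => A x; exact: algHom_ext. Qed.

End Spec.

Record category := Category {
  ob :> Type;
  arr : ob -> ob -> Type;
  arr_id : forall i, arr i i;
  arr_comp : forall i j l, arr j l -> arr i j -> arr i l;
  arr_idl : forall i j (f : arr i j), arr_comp (arr_id j) f = f;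
  arr_idr : forall i j (f : arr i j), arr_comp f (arr_id i) = f;
  arr_compA : forall i j l m (h : arr l m) (g : arr j l) (f : arr i j),
    arr_comp h (arr_comp g f) = arr_comp (arr_comp h g) f
}.
Arguments arr {c} i j.
Arguments arr_id {c} i.
Arguments arr_comp {c i j l} g f.

Section Limits.
Variables (S : comPzSemiRingType) (J : category).

Record diagram := Diagram {
  dia_ob :> J -> scheme S;
  dia_map : forall i j, arr i j -> schemeMor (dia_ob i) (dia_ob j);
  dia_id : forall i, dia_map (arr_id i) = schemeMor_id (dia_ob i);
  dia_comp : forall i j l (g : arr j l) (f : arr i j),
    dia_map (arr_comp g f) = schemeMor_comp (dia_map g) (dia_map f)
}.
Arguments dia_map d {i j} f.

Record cone (D : diagram) (Y : scheme S) := Cone {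
  leg :> forall i, schemeMor Y (D i);
  leg_comm : forall i j (f : arr i j),
    schemeMor_comp (dia_map D f) (leg i) = leg j
}.

Definition is_limit (D : diagram) (L : scheme S) (c : cone D L) : Prop :=
  forall (Y : scheme S) (d : cone D Y),
    exists! u : schemeMor Y L, forall i, schemeMor_comp (c i) u = d i.

End Limits.

(* A homomorphism of monoids-with-zero compatible with the surjections; the
   induced morphism of ambient schemes goes from that of [phi'] to that of
   [phi]. *)
Record embHom (k : comPzSemiRingType) (A : cAlg k) (phi phi' : embedding A) :=
  EmbHom {
    embHom_mon :> F1hom (emb_mon phi) (emb_mon phi');
    embHomE : forall f,
      emb_map phi' (tens_map k embHom_mon f) = emb_map phi f
  }.

Section EmbHom.
Variables (k : comPzSemiRingType) (A : cAlg k).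
Implicit Types phi : embedding A.

Lemma embHom_ext phi phi' (f g : embHom phi phi') : f =1 g -> f = g.
Proof.
case: f g => [f fE] [g gE] /= /F1hom_ext fg; subst g.
by congr EmbHom; exact: Prop_irrelevance.
Qed.

Fact embHom_idE phi f :
  emb_map phi (tens_map k (F1hom_id (emb_mon phi)) f) = emb_map phi f.
Proof. by rewrite tens_map_id. Qed.

Definition embHom_id phi : embHom phi phi := EmbHom (@embHom_idE phi).

Fact embHom_compE phi1 phi2 phi3 (g : embHom phi2 phi3) (h : embHom phi1 phi2)
  f : emb_map phi3 (tens_map k (F1hom_comp g h) f) = emb_map phi1 f.
Proof. by rewrite tens_map_comp [LHS]embHomE embHomE. Qed.

Definition embHom_comp phi1 phi2 phi3 (g : embHom phi2 phi3)
  (h : embHom phi1 phi2) : embHom phi1 phi3 := EmbHom (embHom_compE g h).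

Record affEmb := AffEmb {
  aff_dim : nat;
  aff_map : algHom (tensAlg (F1poly aff_dim) k) A;
  aff_surj : forall a, exists f, aff_map f = a
}.

Definition emb_of_aff (x : affEmb) : embedding A :=
  Embedding (@F1poly_integral (aff_dim x)) (@aff_surj x).

Definition affEmb_cat : category.
Proof.
refine (@Category affEmb
  (fun x y => embHom (emb_of_aff y) (emb_of_aff x))
  (fun x => embHom_id (emb_of_aff x))
  (fun _ _ _ g f => embHom_comp f g) _ _ _) => *; exact: embHom_ext.
Defined.

End EmbHom.

Section TropFunctor.
Variables (R : realType) (k : fieldType) (nu : valuation k R) (A : cAlg k).
Local Notation T := (tropical R).
Implicit Types phi : embedding A.

Definition Trop phi : scheme T := Spec (trop_alg nu phi).

Definition trop_pi phi : algHom (tensAlg (emb_mon phi) T) (trop_alg nu phi) :=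
  quot_pi (A := tensAlg (emb_mon phi) T) _.

(* A homomorphism need not commute with coefficientwise valuation, because terms
   may collide; it still sends bend relations to consequences of bend relations.
   Integrality of the source enters through [del_term_mulmono]. *)
Lemma bend_trop phi phi' (h : embHom phi phi')
    (g g' : tensAlg (emb_mon phi) T) :
  bend (trop_ker nu (emb_map phi)) g g' ->
  trop_pi phi' (tens_map T h g) = trop_pi phi' (tens_map T h g').
Proof.
case=> b0 [Ig _ ->] {g'}; apply/clsP.
elim: Ig b0 => {g} [g [f [f0 ->]] b0||g g' _ IH _ IH' b0|s g _ IH b0].
- apply: bend_map => c; have [cv|cv] := boolP (c \in finsupp
    (tens_val nu (tens_map k h f))); last first.
    by rewrite del_term_id //; exact: congr_refl.
  apply: congr_gen; exists c; split=> //; apply: ideal_gen.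
  by exists (tens_map k h f); split; rewrite ?embHomE.
- by move=> b0; rewrite del_term0; exact: congr_refl.
- by rewrite del_termD !rmorphD; exact: congr_add.
elim/tens_ind: s => [|s s' IHs IHs'|d t].
- by rewrite mul0r del_term0; exact: congr_refl.
- by rewrite mulrDl del_termD !rmorphD; exact: congr_add.
have [[b ->]|->] := del_term_mulmono (emb_int phi) d t b0.
  by rewrite !rmorphM; apply: congr_mul; [exact: congr_refl | exact: IH].
exact: congr_refl.
Qed.

Definition trop_hom phi phi' (h : embHom phi phi') :
    algHom (trop_alg nu phi) (trop_alg nu phi') :=
  quot_lift (A := tensAlg (emb_mon phi) T)
    (g := algHom_comp (trop_pi phi') (tens_map T h)) (bend_trop h).

Lemma trop_homE phi phi' (h : embHom phi phi') x :
  trop_hom h (trop_pi phi x) = trop_pi phi' (tens_map T h x).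
Proof.
by have := quot_lift_cls (A := tensAlg (emb_mon phi) T)
  (g := algHom_comp (trop_pi phi') (tens_map T h)) (bend_trop h) x.
Qed.

Lemma trop_hom_id phi : trop_hom (embHom_id phi) = algHom_id _.
Proof.
apply: (@quot_hom_ext _ (tensAlg (emb_mon phi) T)) => x.
by rewrite [LHS]trop_homE tens_map_id.
Qed.

Lemma trop_hom_comp phi1 phi2 phi3 (g : embHom phi2 phi3)
    (h : embHom phi1 phi2) :
  trop_hom (embHom_comp g h) = algHom_comp (trop_hom g) (trop_hom h).
Proof.
apply: (@quot_hom_ext _ (tensAlg (emb_mon phi1) T)) => x.
rewrite [LHS]trop_homE tens_map_comp.
have := congr1 (trop_hom g) (trop_homE h x).
by rewrite [X in _ = X -> _]trop_homE => <-.
Qed.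

Definition Trop_map phi phi' (h : embHom phi phi') :
  schemeMor (Trop phi') (Trop phi) := Spec_map (trop_hom h).

Definition Trop_diagram : diagram T (affEmb_cat A).
Proof.
refine (@Diagram T (affEmb_cat A) (fun x => Trop (emb_of_aff x))
  (fun _ _ h => Trop_map h) _ _).
  by move=> i; rewrite -Spec_map_id -trop_hom_id.
by move=> i j l g f; rewrite -Spec_map_comp -trop_hom_comp.
Defined.

End TropFunctor.

Section Universal.
Variables (k : fieldType) (A : comAlgType k).
Hypothesis domA : GRing.integral_domain_axiom A.
Local Notation kA := (alg_of_comAlg A).

Fact F1mult_integral : F1integral (F1mult kA).
Proof.
split=> /= [|a b a0 b0 ab|a b c a0 _ _ abc].
- by apply/eqP; exact: oner_neq0.
- by have /orP[/eqP|/eqP] := domA ab.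
apply/eqP; rewrite -subr_eq0.
have /orP[/eqP //|//] : (a == 0) || (b - c == 0).
by apply: domA; rewrite mulrBr abc subrr.
Qed.

Definition ev : algHom (tensAlg (F1mult kA) k) kA :=
  tens_lift (F1hom_id (F1mult kA)).

Fact ev_surj (a : kA) : exists f, ev f = a.
Proof. by exists (mono (a : F1mult kA) 1); exact: tens_liftE. Qed.

Definition univ_emb : embedding kA := Embedding F1mult_integral ev_surj.

Fact univ_homE (phi : embedding kA) f :
  ev (tens_map k (tens_gen (emb_map phi)) f) = emb_map phi f.
Proof.
have e : emb_map phi = algHom_comp ev (tens_map k (tens_gen (emb_map phi))).
  rewrite [LHS](tens_lift_uniq (u := tens_gen (emb_map phi))) //.
  apply/esym/tens_lift_uniq => b.
  have eb := tens_map_mono (tens_gen (emb_map phi)) b (1 : k).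
  by have := congr1 ev eb; rewrite [X in _ = X -> _]tens_liftE.
by rewrite [RHS](congr1 (fun g : algHom _ _ => g f) e).
Qed.

(* On monoids this is [b |-> psi (x_b)], from [B] to M(A). *)
Definition univ_hom (phi : embedding kA) : embHom phi univ_emb :=
  @EmbHom k kA phi univ_emb (tens_gen (emb_map phi)) (@univ_homE phi).

Variables (R : realType) (nu : valuation k R).

Definition Trop_univ : scheme (tropical R) := Trop nu univ_emb.

Fact univ_cone_comm (phi phi' : affEmb_cat kA) (h : arr phi phi') :
  schemeMor_comp (dia_map (Trop_diagram nu kA) h)
    (Trop_map nu (univ_hom (emb_of_aff phi))) =
  Trop_map nu (univ_hom (emb_of_aff phi')).
Proof.
rewrite /= -Spec_map_comp -trop_hom_comp; congr (Spec_map (trop_hom nu _)).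
apply: embHom_ext => b /=.
by rewrite -(embHomE h) tens_map_mono.
Qed.

Definition univ_cone : cone (Trop_diagram nu kA) Trop_univ :=
  Cone univ_cone_comm.

End Universal.

Definition finite_type (k : fieldType) (A : comAlgType k) : Prop :=
  exists s : seq A, forall P : A -> Prop,
    (forall a, a \in s -> P a) -> (forall r : k, P r%:A) ->
    (forall a b, P a -> P b -> P (a + b)) ->
    (forall a b, P a -> P b -> P (a * b)) ->
    forall a, P a.

(* Main.v *)
(* On functors of points the limit is computed pointwise, so the claim is that
   [trop_alg nu (univ_emb domA)] is the colimit of the algebras
   [trop_alg nu phi].  A compatible family [x phi] with values in [C] defines a
   map [u] from [A] to [C]: send [a] to the value of [x phi] on any monomial
   representing [a].  Any two embeddings are refined by a third one, where two
   monomials [x_b], [x_c] with the same image become equal, since [x_b - x_c] is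
   in the kernel; hence [u] is well defined and multiplicative.  Its extension
   to [A (x)_F1 T] respects the bend relations: these reduce to the bends of the
   valuation of a single element of [ker ev], which involves only finitely many
   elements of [A]. *)
Require Import Defs.
From mathcomp Require Import all_boot all_algebra.
From mathcomp Require Import reals.
From mathcomp Require Import finmap boolp.

Set Implicit Arguments.
Unset Strict Implicit.
Unset Printing Implicit Defensive.

Import GRing.Theory.
Local Open Scope ring_scope.

(** * Homomorphisms out of the free monoid-with-zero [F1poly n] *)

Section Monomials.
Variable n : nat.

Definition var (i : 'I_n) : {ffun 'I_n -> nat} := [ffun j => (j == i : nat)].

Lemma ffun_var (m : {ffun 'I_n -> nat}) : m = \sum_i var i *+ m i.
Proof.
apply/ffunP => j; rewrite sum_ffunE (bigD1 j) //= big1 ?addr0 => [|i ij].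
  by rewrite ffunMnE ffunE eqxx natn.
by rewrite ffunMnE ffunE eq_sym (negPf ij) mul0rn.
Qed.

Variable S : comPzSemiRingType.

Lemma F1poly_hom_prod (u : F1hom (F1poly n) (F1mult S)) m :
  u (Some m) = (\prod_i (u (Some (var i)) : S) ^+ m i : S).
Proof.
have uD (a b : {ffun 'I_n -> nat}) :
    u (Some (a + b)) = ((u (Some a) : S) * u (Some b) : S).
  exact: (F1homM u (Some a) (Some b)).
have u0 : u (Some 0) = (1 : S) by exact: (F1hom1 u).
rewrite {1}(ffun_var m) (big_morph (fun m => u (Some m) : S) uD u0).
apply: eq_bigr => i _; elim: (m i) => [|j IH]; first by rewrite mulr0n u0.
by rewrite mulrS uD IH exprS.
Qed.

Lemma F1poly_hom_ext (u v : F1hom (F1poly n) (F1mult S)) :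
  (forall i, u (Some (var i)) = v (Some (var i))) -> u =1 v.
Proof.
move=> uv [m|]; last by rewrite (F1hom0 u) (F1hom0 v).
by rewrite !F1poly_hom_prod; apply: eq_bigr => i _; rewrite uv.
Qed.

Section Eval.
Variable e : 'I_n -> S.

Definition F1poly_eval_fun (b : F1poly n) : F1mult S :=
  if b is Some m then (\prod_i e i ^+ m i : S) else (0 : S).

Fact F1poly_eval1 : F1poly_eval_fun F1one = F1one.
Proof. by rewrite /= big1 // => i _; rewrite ffunE expr0. Qed.

Fact F1poly_evalM a b : F1poly_eval_fun (F1mul a b) =
  F1mul (F1poly_eval_fun a) (F1poly_eval_fun b).
Proof.
case: a b => [a|] [b|] /=; rewrite ?mul0r ?mulr0 // -big_split.
by apply: eq_bigr => i _; rewrite ffunE exprD.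
Qed.

Definition F1poly_eval : F1hom (F1poly n) (F1mult S) :=
  F1Hom F1poly_eval1 F1poly_evalM erefl.

Lemma F1poly_eval_var i : F1poly_eval (Some (var i)) = e i.
Proof.
rewrite /= (bigD1 i) //= big1 ?mulr1 ?ffunE ?eqxx ?expr1 // => j ij.
by rewrite ffunE (negPf ij) expr0.
Qed.

End Eval.

Section Subst.
Variables (p : nat) (v : 'I_n -> {ffun 'I_p -> nat}).

(** Variables go to nonzero monomials only; this suffices because even the element 0 of the target
    algebra can be made the image of a variable. *)
Definition F1poly_subst_fun (b : F1poly n) : F1poly p :=
  if b is Some m then Some (\sum_i v i *+ m i) else None.

Fact F1poly_subst1 : F1poly_subst_fun F1one = F1one.
Proof. by rewrite /= big1 // => i _; rewrite ffunE mulr0n. Qed.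

Fact F1poly_substM a b : F1poly_subst_fun (F1mul a b) =
  F1mul (F1poly_subst_fun a) (F1poly_subst_fun b).
Proof.
case: a b => [a|] [b|] //=; congr Some; rewrite -big_split.
by apply: eq_bigr => i _; rewrite ffunE mulrnDr.
Qed.

Definition F1poly_subst : F1hom (F1poly n) (F1poly p) :=
  F1Hom F1poly_subst1 F1poly_substM erefl.

Lemma F1poly_subst_var i : F1poly_subst (Some (var i)) = Some (v i).
Proof.
congr Some; rewrite /= (bigD1 i) //= big1 ?addr0 ?ffunE ?eqxx ?mulr1n //.
by move=> j ij; rewrite ffunE (negPf ij) mulr0n.
Qed.

End Subst.

End Monomials.

(** * Sums of terms with pairwise distinct monomials *)

Section SumMono.
Variables (B C : F1alg) (S : comPzSemiRingType) (E : {fset B}) (s : B -> C).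
Hypothesis s_inj : {in E &, injective s}.
Hypothesis s_nz : forall b, b \in E -> s b != F1zero.

Lemma coef_sum_mono (r : B -> S) b : b \in E ->
  (\sum_(a <- E) mono (s a) (r a)) (s b) = r b.
Proof.
move=> bE; rewrite Defs.coef_sum (big_fsetD1 b) //= coef_mono eqxx s_nz //=.
rewrite big1_seq ?addr0 // => a /andP[_]; rewrite !inE => /andP[ab aE].
rewrite coef_mono; case: eqP => //= /s_inj ba.
by rewrite ba ?eqxx in ab.
Qed.

Lemma coef_sum_mono_out (r : B -> S) c : (forall b, b \in E -> s b <> c) ->
  (\sum_(a <- E) mono (s a) (r a)) c = 0.
Proof.
move=> cE; rewrite Defs.coef_sum big1_seq // => a /andP[_ aE].
by rewrite coef_mono; case: eqP => // /esym/(cE _ aE).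
Qed.

Lemma del_term_sum_mono (r : B -> S) b : b \in E ->
  del_term (s b) (\sum_(a <- E) mono (s a) (r a)) =
  \sum_(a <- E) if a == b then 0 else mono (s a) (r a).
Proof.
move=> bE; rewrite (big_morph _ (del_termD (s b)) (del_term0 _ (s b))).
apply: eq_big_seq => a aE; rewrite del_term_mono.
by rewrite (inj_in_eq s_inj).
Qed.

End SumMono.

(** * Consequences of the bend relations for one embedding *)

Section TropAlg.
Variables (R : realType) (k : fieldType) (nu : valuation k R) (A : cAlg k).
Local Notation T := (tropical R).

(** Coefficientwise valuation is not additive, but here no two terms collide and none vanishes, so
    it acts on each term separately. *)
Lemma tens_val_sum_mono (B C : F1alg) (E : {fset B}) (s : B -> C)
    (r : B -> k) : {in E &, injective s} ->
  (forall b, b \in E -> s b != F1zero) ->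
  tens_val nu (\sum_(a <- E) mono (s a) (r a)) =
  \sum_(a <- E) mono (s a) (nu (r a)).
Proof.
move=> s_inj s_nz; apply/tensP => c; rewrite tens_val_funE.
have [[b [bE <-]]|cE] := pselect (exists b, b \in E /\ s b = c).
  by rewrite !coef_sum_mono.
by rewrite !coef_sum_mono_out ?val0 // => b bE sb; apply: cE; exists b.
Qed.

(** If [b] is not a monomial of the valuation, deleting it changes nothing, so [b] may be
    arbitrary. *)
Lemma trop_pi_bend (phi : embedding A) f b : emb_map phi f = 0 ->
  trop_pi nu phi (tens_val nu f) = trop_pi nu phi (del_term b (tens_val nu f)).
Proof.
move=> f0; apply/clsP.
have [bf|bf] := boolP (b \in finsupp (tens_val nu f)); last first.
  by rewrite del_term_id //; exact: congr_refl.
by apply: congr_gen; exists b; split=> //; apply: ideal_gen; exists f.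
Qed.

(* The binomial [x_b - x_c] lies in the kernel, and both of its bends are single
   terms with coefficient [nu 1 = nu (-1) = 1]. *)
Lemma trop_pi_mono_eq (phi : embedding A) (b c : emb_mon phi) :
  emb_map phi (mono b 1) = emb_map phi (mono c 1) ->
  trop_pi nu phi (mono b 1) = trop_pi nu phi (mono c 1).
Proof.
move=> bc; have [->//|nbc] := eqVneq b c.
pose f : tens (emb_mon phi) k := mono b 1 + mono c (-1).
have f0 : emb_map phi f = 0.
  (* [A] is only a semiring over [k], so the cancellation takes place among the scalars. *)
  have -> : (0 : A) = emb_map phi (mono b (1 - 1)).
    by rewrite subrr mono0 rmorph0.
  have e d : mono d (-1) = alg_str (tensAlg (emb_mon phi) k) (-1) * mono d 1.
    by rewrite /= mono_mul F1mul1 mulr1.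
  by rewrite monoD !rmorphD !e !rmorphM bc.
have fE : tens_val nu f = mono b 1 + mono c 1.
  apply/tensP => x; rewrite tens_val_funE !Defs.coefD !coef_mono.
  have [->|xb] := eqVneq x b; last first.
    by rewrite /= !add0r; case: ifP => _; rewrite ?val0 ?valN1.
  by rewrite (negPf nbc) /= !addr0; case: ifP => _;
    [exact: Defs.val1 | exact: val0].
have := trop_pi_bend b f0; rewrite (trop_pi_bend c f0) fE !del_termD.
by rewrite !del_term_mono !eqxx (negPf nbc) eq_sym (negPf nbc) addr0 add0r.
Qed.

End TropAlg.

(** * Refinement of affine embeddings *)

(** By freeness, any choice of monomials for the variables extends to a homomorphism, and its
    compatibility with the surjections is tested on variables. *)
Lemma affEmb_refine (k : fieldType) (A : cAlg k) (phi phi' : affEmb A) :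
  (forall i, exists m, aff_map phi' (mono (Some m : F1poly _) 1) =
    aff_map phi (mono (Some (var i) : F1poly _) 1)) ->
  inhabited (embHom (emb_of_aff phi) (emb_of_aff phi')).
Proof.
move=> /choice[v vE]; pose h := F1poly_subst v.
have hE : tens_gen (aff_map phi) =1 F1hom_comp (tens_gen (aff_map phi')) h.
  apply: F1poly_hom_ext => i; rewrite /= -vE.
  by congr (aff_map phi' (mono _ 1)); rewrite -F1poly_subst_var.
have e : algHom_comp (aff_map phi') (tens_map k h) = aff_map phi.
  rewrite [RHS](tens_lift_uniq (u := tens_gen (aff_map phi))) //.
  apply: tens_lift_uniq => b; rewrite hE.
  exact: (congr1 (aff_map phi') (tens_map_mono h b (1 : k))).
apply: inhabits; apply: (@EmbHom k A (emb_of_aff phi) (emb_of_aff phi') h).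
by move=> f; exact: (congr1 (fun g : algHom _ _ => g f) e).
Qed.

(** * The universal tropical algebra as a colimit over affine embeddings *)

Section Colimit.
Variables (R : realType) (k : fieldType) (nu : valuation k R).
Variables (A : comAlgType k).
Local Notation T := (tropical R).
Local Notation kA := (alg_of_comAlg A).
Local Notation val phi b := (aff_map phi (mono b 1)).
Hypothesis ftA : finite_type A.

(** The coordinates are the elements of [l] followed by a finite generating family; the latter
    ensures surjectivity. *)
Lemma affEmb_through (l : seq A) : exists phi : affEmb kA,
  forall a, a \in l -> exists m, val phi (Some m : F1poly _) = a :> A.
Proof.
have [s sP] := ftA; pose l' := (l ++ s)%SEQ.
pose g : algHom (tensAlg (F1poly (size l')) k) kA :=
  tens_lift (F1poly_eval (S := kA) (fun i => l'`_i)).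
have gl a : a \in l' -> exists m, g (mono (Some m : F1poly _) 1) = a.
  move=> al; have il : (index a l' < size l')%N by rewrite index_mem.
  exists (var (Ordinal il)); rewrite [LHS]tens_liftE.
  by rewrite [LHS]F1poly_eval_var /= nth_index.
have gs a : exists f, g f = a.
  apply: (sP (fun a => exists f, g f = a)) => {a}
    [a al|r|a b [f <-] [f' <-]|a b [f <-] [f' <-]].
  - by have [|m <-] := gl a; [rewrite mem_cat al orbT | eexists].
  - by exists (alg_str (tensAlg (F1poly (size l')) k) r); rewrite alg_mapE.
  - by exists (f + f'); rewrite rmorphD.
  - by exists (f * f'); rewrite rmorphM.
by exists (AffEmb gs) => a al; apply: gl; rewrite mem_cat al.
Qed.

(** An embedding through all coordinates of [phi] and [phi'] refines both. *)
Lemma affEmb_directed (phi phi' : affEmb kA) : exists psi : affEmb kA,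
  inhabited (embHom (emb_of_aff phi) (emb_of_aff psi)) /\
  inhabited (embHom (emb_of_aff phi') (emb_of_aff psi)).
Proof.
pose l (x : affEmb kA) :=
  [seq (val x (Some (var i) : F1poly _) : A) | i : 'I_(aff_dim x)].
have [psi psiP] := affEmb_through (l phi ++ l phi').
exists psi; split; apply: affEmb_refine => i; apply: psiP; rewrite mem_cat.
  by rewrite image_f.
by rewrite orbC image_f.
Qed.

Variables (C : cAlg T).
Variable x : forall phi : affEmb kA, algHom (trop_alg nu (emb_of_aff phi)) C.
Hypothesis xE : forall phi phi'
    (h : embHom (emb_of_aff phi) (emb_of_aff phi')),
  algHom_comp (x phi') (trop_hom nu h) = x phi.

Definition xmon (phi : affEmb kA) (b : F1poly (aff_dim phi)) : C :=
  x phi (trop_pi nu (emb_of_aff phi) (mono b 1)).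

Lemma xmon_hom phi phi' (h : embHom (emb_of_aff phi) (emb_of_aff phi')) b :
  @xmon phi' (h b) = @xmon phi b.
Proof.
rewrite /xmon -[x phi](xE h) -(tens_map_mono h).
exact/esym/(congr1 (x phi'))/trop_homE.
Qed.

Lemma xmon_wd phi phi' b b' : val phi b = val phi' b' ->
  @xmon phi b = @xmon phi' b'.
Proof.
move=> bb'; have [psi [[h] [h']]] := affEmb_directed phi phi'.
rewrite -(xmon_hom h) -(xmon_hom h'); congr (x psi _).
apply: trop_pi_mono_eq; rewrite -!(tens_map_mono (S := k)).
by rewrite (embHomE h) (embHomE h').
Qed.

Lemma umap_exists : exists u : F1hom (F1mult kA) (F1mult C),
  forall phi b, u (val phi b) = @xmon phi b.
Proof.
have /choice[u uE] : forall a : A, exists c : C,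
    forall (phi : affEmb kA) b, val phi b = a -> @xmon phi b = c.
  move=> a; have [phi phiP] := affEmb_through [:: a].
  have [|m mE] := phiP a; first by rewrite mem_head.
  exists (@xmon phi (Some m : F1poly _)) => psi b ba.
  by apply: xmon_wd; rewrite ba mE.
have [phi0 _] := affEmb_through [::].
have u1 : u 1 = 1.
  rewrite -(uE 1 phi0 F1one) ?rmorph1 //.
  by rewrite /xmon !rmorph1.
have u0 : u 0 = 0.
  by rewrite -(uE 0 phi0 F1zero) /xmon ?monoz ?rmorph0.
(* One embedding in which both [a] and [b] are monomials; their product is then a monomial over
   [a * b]. *)
have uM a b : u (a * b) = u a * u b.
  have [phi phiP] := affEmb_through [:: a; b].
  have [|m mE] := phiP a; first by rewrite mem_head.
  have [|m' mE'] := phiP b; first by rewrite !inE eqxx orbT.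
  rewrite -(uE _ _ _ mE) -(uE _ _ _ mE').
  rewrite -(uE (a * b) phi (F1mul (Some m : F1poly _) (Some m'))).
    by rewrite /xmon -!rmorphM mono_mul mulr1.
  by rewrite -mE -mE' -rmorphM mono_mul mulr1.
exists (F1Hom (B := F1mult kA) (C := F1mult C) (F1fun := u) u1 uM u0).
by move=> phi b; rewrite /= -(uE _ phi b).
Qed.

Hypothesis domA : GRing.integral_domain_axiom A.
Local Notation uhom phi := (univ_hom domA (emb_of_aff phi)).

Section Descent.
Variable u : F1hom (F1mult kA) (F1mult C).
Hypothesis uE : forall phi b, u (val phi b) = @xmon phi b.

(** Both sides are homomorphisms out of a free algebra and agree on monomials. Hence an identity at
    the universal level can be checked in a finite embedding through which its terms factor. *)
Lemma umap_tens_map (phi : affEmb kA) (g : tens (F1poly (aff_dim phi)) T) :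
  tens_lift u (tens_map T (uhom phi) g) =
  x phi (trop_pi nu (emb_of_aff phi) g).
Proof.
pose xpi := algHom_comp (x phi) (trop_pi nu (emb_of_aff phi)).
have e : algHom_comp (tens_lift u) (tens_map T (uhom phi)) = xpi.
  rewrite [RHS](tens_lift_uniq (u := tens_gen xpi)) //.
  apply: tens_lift_uniq => b.
  rewrite [RHS](_ : _ = u (uhom phi b)); last by rewrite /= uE.
  rewrite -[RHS]tens_liftE.
  exact: (congr1 (tens_lift u) (tens_map_mono (uhom phi) b (1 : T))).
exact: (congr1 (fun h : algHom (tensAlg (F1poly _) T) C => h g) e).
Qed.

(* A relation among finitely many elements of [A] is already visible in a finite
   embedding having these elements among its coordinates. *)
Lemma umap_bend_val (f : tens (F1mult kA) k) a0 : ev A f = 0 ->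
  tens_lift u (del_term a0 (tens_val nu f)) = tens_lift u (tens_val nu f).
Proof.
move=> f0; have [a0f|a0f] := boolP (a0 \in finsupp f); last first.
  rewrite del_term_id // mem_finsupp tens_val_funE fsfun_dflt //.
  by rewrite val0 eqxx.
have [phi phiP] := affEmb_through (finsupp f : {fset A}).
have [s sP] : exists s : A -> F1poly (aff_dim phi),
    forall a, a \in (finsupp f : {fset A}) -> val phi (s a) = a.
  suff /choice[s sP] : forall a, exists b : F1poly (aff_dim phi),
      a \in (finsupp f : {fset A}) -> val phi b = a by exists s.
  move=> a; have [/phiP[m mE]|] := boolP (a \in (finsupp f : {fset A})).
    by exists (Some m).
  by exists F1zero.
pose E := finsupp f.
have s_inj : {in E &, injective s}.
  by move=> a b aE bE sab; rewrite -(sP a aE) -(sP b bE) sab.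
have s_nz a : a \in E -> s a != F1zero.
  move=> aE; apply/eqP => sa; move: (aE); rewrite mem_finsupp.
  by rewrite -(sP a aE) sa monoz rmorph0 [f _]coefz eqxx.
(* [f'] lifts [f] term by term. As [s] is injective and avoids zero, no terms merge or vanish, so
   taking valuations and deleting a term both carry over from [f'] to [f]. *)
pose f' : tens (F1poly (aff_dim phi)) k := \sum_(a <- E) mono (s a) (f a).
have mapE (S : comPzSemiRingType) a (r : S) : a \in E ->
    tens_map S (uhom phi) (mono (s a) r) = mono (a : F1mult kA) r.
  by move=> aE; rewrite tens_map_mono /= sP.
have f'0 : emb_map (emb_of_aff phi) f' = 0.
  rewrite -(embHomE (uhom phi)) -[RHS]f0; congr (ev A _).
  rewrite (raddf_sum (tens_map k (uhom phi))) [RHS]tens_decomp.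
  by apply: eq_big_seq => a aE; exact: mapE.
have E_nz (a : F1mult kA) : a \in E -> a != F1zero.
  by move=> aE; apply/eqP => az; move: aE; rewrite az mem_finsupp coefz eqxx.
have fE : tens_val nu f = \sum_(a <- E) mono (a : F1mult kA) (nu (f a)).
  by rewrite {1}(tens_decomp f) (@tens_val_sum_mono _ _ _ _ _ _ id).
have f'E : tens_val nu f' = \sum_(a <- E) mono (s a) (nu (f a)).
  exact: tens_val_sum_mono.
have vE : tens_val nu f = tens_map T (uhom phi) (tens_val nu f').
  rewrite fE f'E (raddf_sum (tens_map T (uhom phi))).
  by apply: eq_big_seq => a aE; exact/esym/mapE.
have dE : del_term a0 (tens_val nu f) =
    tens_map T (uhom phi) (del_term (s a0) (tens_val nu f')).
  rewrite fE f'E (del_term_sum_mono s_inj) //.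
  rewrite [LHS](@del_term_sum_mono _ _ _ E id) //.
  rewrite (raddf_sum (tens_map T (uhom phi))).
  apply: eq_big_seq => a aE.
  by case: ifP => _; [exact/esym/raddf0 | exact/esym/mapE].
rewrite dE vE !umap_tens_map; congr (x phi _); apply/esym.
exact: trop_pi_bend.
Qed.

(** Induction on membership in the ideal, with the deleted monomial kept arbitrary: multiplying by a
    term shifts it. Cancellation in the domain [A] makes deletion commute with this shift. *)
Lemma umap_bend g g' :
  bend (trop_ker nu (emb_map (univ_emb domA))) g g' ->
  tens_lift u g = tens_lift u g'.
Proof.
case=> a [Ig _ ->] {g'}; apply/esym.
elim: Ig a => {g} [g [f [f0 ->]] a||g g' _ IH _ IH' a|t g _ IH a].
- exact: umap_bend_val.
- by move=> a; rewrite del_term0.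
- by rewrite del_termD !rmorphD IH IH'.
elim/tens_ind: t => [|t t' IHt IHt'|d r].
- by rewrite mul0r del_term0.
- by rewrite mulrDl del_termD !rmorphD IHt IHt'.
have [[b ->]|-> //] := del_term_mulmono (F1mult_integral domA) d r a.
by rewrite !rmorphM IH.
Qed.

End Descent.

Lemma trop_univ_colim : exists! y : algHom (trop_alg nu (univ_emb domA)) C,
  forall phi, algHom_comp y (trop_hom nu (uhom phi)) = x phi.
Proof.
have [u uE] := umap_exists.
exists (quot_lift (A := tensAlg _ T) (umap_bend uE)); split=> [phi|y yE].
  apply: (@quot_hom_ext _ (tensAlg (emb_mon (emb_of_aff phi)) T)) => g.
  rewrite -[RHS](umap_tens_map uE).
  rewrite -[RHS](quot_liftE (A := tensAlg _ T) (umap_bend uE)).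
  exact: (congr1 (quot_lift (A := tensAlg _ T) (umap_bend uE))
    (trop_homE _ _ g)).
apply: (@quot_hom_ext _ (tensAlg (F1mult kA) T)) => g.
rewrite [LHS](quot_liftE (A := tensAlg _ T)).
apply/esym; apply: (congr1 (fun h : algHom _ _ => h g)
  (x := algHom_comp y (trop_pi nu (univ_emb domA)))).
apply: tens_lift_uniq => a.
(* Every [a] is the image of a monomial of some affine embedding [phi], so [yE phi] forces the value
   of [y] on the class of the generator of [a]. *)
have [phi phiP] := affEmb_through [:: a : A].
have [|m mE] := phiP a; first by rewrite mem_head.
have := congr1 (fun h : algHom _ _ => h (trop_pi nu (emb_of_aff phi)
  (mono (Some m : F1poly _) 1))) (yE phi).
rewrite -/(xmon _) -uE mE => <-.
apply: (congr1 y); rewrite [RHS]trop_homE; congr (trop_pi _ _ _).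
by rewrite tens_map_mono /= mE.
Qed.

End Colimit.

(** * From colimits of algebras to limits of schemes *)

(** The two mediating morphisms are mutually inverse, since each composite and the identity induce
    the same cone. Compatibility with the legs alone already gives uniqueness. *)
Lemma limit_uniq_iso (S : comPzSemiRingType) (J : category) (D : diagram S J)
    (X L : scheme S) (c : cone D X) (d : cone D L) :
  is_limit c -> is_limit d ->
  exists! f : schemeMor L X,
    is_iso f /\ forall i, schemeMor_comp (c i) f = d i.
Proof.
move=> limc limd; have [f [fE f_uniq]] := limc L d.
have [g [gE _]] := limd X c.
exists f; split=> [|f' [_ f'E]]; last exact: f_uniq.
split=> //; exists g; split.
  have [h [_ h_uniq]] := limd L d.
  rewrite -(h_uniq (schemeMor_comp g f)) => [|i].
    by apply: h_uniq => i; exact: schemeMor_ext.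
  rewrite -[RHS]fE -gE; exact: schemeMor_ext.
have [h [_ h_uniq]] := limc X c.
rewrite -(h_uniq (schemeMor_comp f g)) => [|i].
  by apply: h_uniq => i; exact: schemeMor_ext.
rewrite -[RHS]gE -fE; exact: schemeMor_ext.
Qed.

(** Over a point [y] of an arbitrary scheme [Y] with values in [C], a cone is a compatible family of
    homomorphisms into [C]. The colimit property turns it into a point of [Trop_univ], and its
    uniqueness clause makes this natural in [C]. *)
Lemma univ_cone_limit (R : realType) (k : fieldType) (nu : valuation k R)
    (A : comAlgType k) (domA : GRing.integral_domain_axiom A) :
  finite_type A -> is_limit (univ_cone domA nu).
Proof.
move=> ftA Y d.
(* Arrows of [affEmb_cat] are reversed: an [embHom] from [phi] to [phi'] is an arrow from [phi'] to
   [phi]. *)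
have colim C (y : Y C) := @trop_univ_colim R k nu A ftA C
  (fun phi => d phi C y)
  (fun phi phi' h => congr1 (fun f : schemeMor _ _ => f C y)
    (leg_comm d (h : @arr (affEmb_cat _) phi' phi))) domA.
pose v C (y : Y C) := cid (colim C y).
have v_uniq C (y : Y C) z :
    (forall phi, algHom_comp z
      (trop_hom nu (univ_hom domA (emb_of_aff phi))) = d phi C y) ->
    projT1 (v C y) = z.
  by have [_] := projT2 (v C y); apply.
have vE C (y : Y C) phi : algHom_comp (projT1 (v C y))
    (trop_hom nu (univ_hom domA (emb_of_aff phi))) = d phi C y.
  by have [] := projT2 (v C y).
have v_nat C C' (g : algHom C C') (y : Y C) :
    projT1 (v C' (sf_map g y)) = algHom_comp g (projT1 (v C y)).
  apply: v_uniq => phi; rewrite (mor_nat (d phi)) -vE.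
  exact: algHom_ext.
exists (@SchemeMor _ Y (Trop_univ domA nu) (fun C y => projT1 (v C y)) v_nat).
split=> [phi|f fE]; apply: schemeMor_ext => C y; first exact: vE.
apply: v_uniq => phi.
exact: (congr1 (fun h : schemeMor _ _ => h C y) (fE phi)).
Qed.

(** The first conjunct provides existence of the limit; naturality of the isomorphism is its
    compatibility with the projections to the finite tropicalizations. *)
Theorem theorem3 (R : realType) (k : fieldType) (nu : valuation k R)
    (A : comAlgType k) (domA : GRing.integral_domain_axiom A)
    (ftA : finite_type A) :
  is_limit (univ_cone domA nu) /\
  forall (L : scheme (tropical R))
      (c : cone (Trop_diagram nu (alg_of_comAlg A)) L),
    is_limit c ->
    exists! f : schemeMor L (Trop_univ domA nu),
      is_iso f /\
      forall phi, schemeMor_comp (univ_cone domA nu phi) f = c phi.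
Proof.
have lim := @univ_cone_limit R k nu A domA ftA.
by split=> // L c limc; exact: limit_uniq_iso lim limc.
Qed.
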